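(* Let $k$ be any field. For all integers $n\geq 1$, both of the graphs $G_n$ and $H_n$ are well-covered and vertex decomposable, with $\alpha(G_n)=\alpha(H_n)=n$. In particular, $G_n$ and $H_n$ are Cohen-Macaulay over $k$.
   Context: For an integer $n\ge 1$, $G_n$ is the graph with vertex set $\{x_1,\ldots,x_{3n-1}\}$ whose edges are: $x_1x_2$; for each $k=1,\ldots,n-1$ the four edges $x_{3k-1}x_{3k}$, $x_{3k}x_{3k+1}$, $x_{3k+1}x_{3k+2}$, $x_{3k+2}x_{3k-2}$; and for each $l=2,\ldots,n-1$ the edge $x_{3l-3}x_{3l}$. The graph $H_n$ is $G_n\setminus x_{3n-1}$, i.e. the induced subgraph of $G_n$ on $\{x_1,\ldots,x_{3n-2}\}$. $\alpha(G)$ is the maximum cardinality of an independent set of $G$. $G$ is well-covered if all its maximal (under inclusion) independent sets have the same cardinality. $G$ is Cohen-Macaulay over $k$ if $R/I(G)$ is a Cohen-Macaulay ring, where $R$ is the polynomial ring over $k$ on the vertices of $G$ and $I(G)$ is generated by all products of two adjacent vertices. For a vertex $v$, let $N_G[v]$ be the set consisting of $v$ and its neighbours, $G\setminus W$ the induced subgraph on $V(G)\setminus W$, and $G_v=G\setminus N_G[v]$. Vertex decomposability is defined recursively: $G$ is vertex decomposable if it has no edges, or if it has a vertex $v$ such that (i) $G\setminus v$ and $G_v$ are both vertex decomposable, and (ii) no independent set in $G_v$ is a maximal independent set in $G\setminus v$. *)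

(* Defs.v *)
From HB Require Import structures.
From mathcomp Require Import all_boot all_algebra ring_quotient.
From mathcomp Require Import boolp.
From mathcomp Require Import mpoly zify.

Set Implicit Arguments.
Unset Strict Implicit.
Unset Printing Implicit Defensive.

Import GRing.Theory.

(* The edges of a graph are the adj-related pairs of elements of [vertices];
   the values of [adj] outside [vertices] are irrelevant, so that an induced
   subgraph keeps the same [adj]. *)
Record graph (T : finType) := Graph {
  vertices : {set T};
  adj : rel T;
  adj_sym : ssrbool.symmetric adj;
  adj_irr : irreflexive adj }.

Section GraphNotions.
Variable T : finType.
Implicit Types (G : graph T) (A W : {set T}) (v : T).

Definition del G W : graph T :=
  Graph (vertices G :\: W) (@adj_sym T G) (@adj_irr T G).

Definition closed_nbhd G v : {set T} :=
  [set u in vertices G | (u == v) || adj G v u].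

Definition independent G A : bool :=
  (A \subset vertices G) && [forall x in A, forall y in A, ~~ adj G x y].

Definition maximal_independent G A : bool := maxset (independent G) A.

Definition alpha G : nat := \max_(A : {set T} | independent G A) #|A|.

Definition well_covered G : Prop :=
  forall A B, maximal_independent G A -> maximal_independent G B -> #|A| = #|B|.

Inductive vertex_decomposable : graph T -> Prop :=
| vd_edgeless G :
    (forall x y, x \in vertices G -> y \in vertices G -> ~~ adj G x y) ->
    vertex_decomposable G
| vd_shedding G v :
    v \in vertices G ->
    vertex_decomposable (del G [set v]) ->
    vertex_decomposable (del G (closed_nbhd G v)) ->
    (forall A, independent (del G (closed_nbhd G v)) A ->
       ~~ maximal_independent (del G [set v]) A) ->
    vertex_decomposable G.

End GraphNotions.

(* Ideals are boolean predicates, as in ring_quotient; thanks to boolp every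
   Prop-valued predicate is of this form. [idealr_closed] includes properness
   (1 is not a member). *)
Section CohenMacaulayRings.
Local Open Scope ring_scope.
Variable A : comNzRingType.
Implicit Types (P J : {pred A}) (s : seq A).

Definition in_ideal_gen s (x : A) : Prop :=
  exists c : nat -> A, x = \sum_(i < size s) c i * s`_i.

(* Proper ideals suffice, the unit ideal being generated by 1. *)
Definition noetherian : Prop :=
  forall J, idealr_closed J -> exists s, forall x, x \in J <-> in_ideal_gen s x.

Definition is_prime_ideal P : Prop := idealr_closed P /\ prime_idealr_closed P.

Definition is_maximal_ideal P : Prop :=
  idealr_closed P /\
  forall J, idealr_closed J -> {subset P <= J} -> J =i P.

(* Q 0 < Q 1 < ... < Q r = P, a chain of primes of length r. *)
Definition has_prime_chain P (r : nat) : Prop :=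
  exists Q : nat -> {pred A},
    [/\ forall i, (i <= r)%N -> is_prime_ideal (Q i),
        forall i, (i < r)%N -> {subset Q i <= Q i.+1} /\ ~ (Q i =i Q i.+1)
      & Q r =i P].

Definition regular_sequence s : Prop :=
  (forall i, (i < size s)%N -> forall a,
     in_ideal_gen (take i s) (a * s`_i) -> in_ideal_gen (take i s) a) /\
  ~ in_ideal_gen s 1.

Definition has_regular_sequence P (r : nat) : Prop :=
  exists s, [/\ size s = r, {subset s <= P} & regular_sequence s].

Definition is_greatest (S : nat -> Prop) (m : nat) : Prop :=
  S m /\ forall r, S r -> (r <= m)%N.

Definition height_is P : nat -> Prop := is_greatest (has_prime_chain P).

Definition grade_is P : nat -> Prop := is_greatest (has_regular_sequence P).

(* The definition of Kaplansky and Eisenbud: grade = height at every maximal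
   ideal; it amounts to depth = dimension for every localization at a maximal
   ideal. *)
Definition cohen_macaulay_ring : Prop :=
  noetherian /\
  forall P, is_maximal_ideal P -> exists d, height_is P d /\ grade_is P d.

End CohenMacaulayRings.

Section EdgeIdeal.
Local Open Scope ring_scope.
Variables (k : fieldType) (T : finType) (G : graph T).

(* The variable 'X_i stands for the vertex enum_val i of G. *)
Definition edge_monomials : seq {mpoly k[#|vertices G|]} :=
  [seq 'X_e.1 * 'X_e.2 |
     e <- enum [set e : 'I_#|vertices G| * 'I_#|vertices G|
                  | adj G (enum_val e.1) (enum_val e.2)]].

Definition edge_ideal : {pred {mpoly k[#|vertices G|]}} :=
  fun p => `[< in_ideal_gen edge_monomials p >].

Lemma edge_ideal_closed : idealr_closed edge_ideal.
Proof.
split.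
- apply/asboolP; exists (fun=> 0).
  by rewrite big1 // => i _; rewrite mul0r.
- apply/asboolP => -[c /(congr1 (meval (fun=> 0)))].
  rewrite rmorph1 raddf_sum big1 => [/eqP|i _ /=]; first by rewrite oner_eq0.
  have /mapP[e _ ->] : edge_monomials`_i \in edge_monomials by rewrite mem_nth.
  by rewrite !rmorphM /= !mevalXU !mulr0.
- move=> a p q /asboolP[c ->] /asboolP[d ->]; apply/asboolP.
  exists (fun i => a * c i + d i).
  rewrite mulr_sumr -big_split /=; apply: eq_bigr => i _.
  by rewrite mulrDl mulrA.
Qed.

HB.instance Definition _ :=
  isIdealr.Build {mpoly k[#|vertices G|]} edge_ideal edge_ideal_closed.

Definition cohen_macaulay_graph : Prop :=
  cohen_macaulay_ring {ideal_quot edge_ideal}.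

End EdgeIdeal.

Section GH.
Variable n : nat.

Definition edge_dir (i j : nat) : bool :=
  [|| (i, j) == (1, 2),
      [exists k : 'I_n, (1 <= k) &&
         ((i, j) \in [:: (3 * k - 1, 3 * k); (3 * k, 3 * k + 1);
                         (3 * k + 1, 3 * k + 2); (3 * k + 2, 3 * k - 2)])]
    | [exists l : 'I_n, (2 <= l) && ((i, j) == (3 * l - 3, 3 * l))]].

Definition edgeG : rel 'I_(3 * n) := fun i j => edge_dir i j || edge_dir j i.

Lemma edgeG_sym : ssrbool.symmetric edgeG.
Proof. by move=> i j; rewrite /edgeG orbC. Qed.

Lemma edgeG_irr : irreflexive edgeG.
Proof.
move=> i; rewrite /edgeG orbb; apply/negP => /or3P[/eqP[]||].
- lia.
- move=> /existsP[k /andP[k1]]; rewrite !inE !xpair_eqE; lia.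
- move=> /existsP[l /andP[l2]]; rewrite !xpair_eqE; lia.
Qed.

(* x_i is i : 'I_(3 * n), for 1 <= i <= 3 * n - 1. *)
Definition graphG : graph 'I_(3 * n) :=
  Graph [set i : 'I_(3 * n) | 1 <= i] edgeG_sym edgeG_irr.

Definition graphH : graph 'I_(3 * n) :=
  del graphG [set i : 'I_(3 * n) | i == 3 * n - 1 :> nat].

End GH.

(* Main.v *)
(* The edge ring A of a graph is the face ring of its independence complex. When
   the graph is vertex decomposable with all maximal independent sets of size n,
   the shedding vertices give exact sequences
   0 -> R/(J : x) -> R/J -> R/(J + (x)) -> 0 of face rings which reduce the
   weak regularity of a sequence modulo J to the case where J is the ideal of a
   simplex with n vertices. For G_n and H_n the linear forms
   t_j = x_(3j) + x_(3j+1) + x_(3j+2) + x_(3j+3), for j < n, restrict to a system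
   of coordinates on each of these simplices, whatever the field. By Zariski's
   lemma a maximal ideal P of A contains f_j(t_j) for some nonzero univariate
   polynomials f_j, and these n elements form a regular sequence. Conversely a
   regular sequence of length r in P yields a chain of primes of length r below P,
   and r <= n for such a chain, because A has only O(D^n) face monomials of degree
   at most D. Hence grade and height of P are both n. *)
From HB Require Import structures.
Require Import Defs.
From mathcomp Require Import all_boot all_algebra generic_quotient ring_quotient.
From mathcomp Require classical_sets.
From mathcomp Require Import boolp mpoly zify ring.

Set Implicit Arguments.
Unset Strict Implicit.
Unset Printing Implicit Defensive.

Import GRing.Theory.
Local Open Scope ring_scope.
Local Open Scope quotient_scope.

(** * Ideals, weakly regular sequences and chains of primes *)

(** The condition bears on all maximal ideals, over a field that need not be algebraically closed:
    the residue of t_j is then only algebraic over k, so differences of t_j and a constant do not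
    suffice and a polynomial f_j(t_j) takes their place. Its leading coefficient is a unit of k, and
    this alone makes it regular once t_j can be moved while the other t_i stay fixed.

    In the exact sequence, the colon ideal (J : x) belongs to the star of the vertex, not to its
    link. The link has facets with one vertex less and would call for fewer parameters; with the
    star, n and the whole sequence stay the same throughout the induction.

    The forms t_j and t_(j+1) share x_(3j+3) because a maximal independent set may miss both
    x_(3j+1) and x_(3j+2). A shared vertex, minus a vertex lying in the neighbouring form only, then
    separates t_j from the other forms. All coefficients are 0, 1 or -1, which is why the
    characteristic does not matter.

    Krull's height theorem is avoided: lower bounds on the height come from Zorn's lemma, upper
    bounds from the D^r linearly independent elements of degree O(D) which a chain of length r
    provides. *)

Section Ideals.
Import classical_sets.
Variable R : comNzRingType.
Implicit Types (J K : R -> Prop) (a b x y : R) (s : seq R).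

(** Unlike [idealr_closed], this allows the unit ideal, which may arise as a colon ideal or as
    [adjoin J a]. *)
Definition ideal J :=
  [/\ J 0, forall x y, J x -> J y -> J (x + y) & forall a x, J x -> J (a * x)].

Definition adjoin J a : R -> Prop := fun x => exists b, J (x - b * a).

Lemma ideal0 J : ideal J -> J 0. Proof. by case. Qed.

Lemma idealD J x y : ideal J -> J x -> J y -> J (x + y).
Proof. by case=> _ h _; apply: h. Qed.

Lemma ideal_mull J a x : ideal J -> J x -> J (a * x).
Proof. by case=> _ _ h; apply: h. Qed.

Lemma ideal_mulr J a x : ideal J -> J x -> J (x * a).
Proof. by rewrite mulrC; apply: ideal_mull. Qed.

Lemma idealN J x : ideal J -> J x -> J (- x).
Proof. by rewrite -mulN1r; apply: ideal_mull. Qed.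

Lemma idealB J x y : ideal J -> J x -> J y -> J (x - y).
Proof. by move=> iJ Jx /(idealN iJ); apply: idealD. Qed.

Lemma ideal_sum J (I : Type) (r : seq I) (P : pred I) (F : I -> R) :
  ideal J -> (forall i, P i -> J (F i)) -> J (\sum_(i <- r | P i) F i).
Proof.
by move=> iJ JF; apply: big_ind => //; [exact: ideal0|move=> *; exact: idealD].
Qed.

Lemma ideal_zero : ideal (fun x => x = 0).
Proof.
by split=> // [x y -> ->|a x ->]; [rewrite addr0|rewrite mulr0].
Qed.

Lemma ideal_adjoin J a : ideal J -> ideal (adjoin J a).
Proof.
move=> iJ; split.
- by exists 0; rewrite mul0r subr0; apply: ideal0.
- move=> x y [b Jb] [c Jc]; exists (b + c).
  by have := idealD iJ Jb Jc; congr J; ring.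
- move=> c x [b Jb]; exists (c * b).
  by have := ideal_mull c iJ Jb; congr J; ring.
Qed.

Lemma sub_adjoin J a x : J x -> adjoin J a x.
Proof. by exists 0; rewrite mul0r subr0. Qed.

Lemma mem_adjoin J a : ideal J -> adjoin J a a.
Proof. by exists 1; rewrite mul1r subrr; apply: ideal0. Qed.

Lemma adjoin_sub J K a : ideal K -> (forall x, J x -> K x) -> K a ->
  forall x, adjoin J a x -> K x.
Proof.
move=> iK JK Ka x [b /JK Kb].
by have := idealD iK Kb (ideal_mull b iK Ka); rewrite subrK.
Qed.

Lemma adjoin_eq J K a : (forall x, J x <-> K x) ->
  forall x, adjoin J a x <-> adjoin K a x.
Proof. by move=> JK x; split=> -[b /JK]; exists b. Qed.

Lemma ideal_idspan J s : ideal J -> ideal (foldl adjoin J s).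
Proof. by elim: s J => //= a s IHs J /(ideal_adjoin a)/IHs. Qed.

Lemma sub_idspan J s x : J x -> foldl adjoin J s x.
Proof. by elim: s J => //= a s IHs J /(sub_adjoin a)/IHs. Qed.

Lemma mem_idspan J s x : ideal J -> x \in s -> foldl adjoin J s x.
Proof.
elim: s J => //= a s IHs J iJ; rewrite inE => /predU1P[->|xs].
  exact/sub_idspan/mem_adjoin.
exact: IHs (ideal_adjoin a iJ) xs.
Qed.

Lemma idspan_sub J K s : ideal K -> (forall x, J x -> K x) ->
  (forall x, x \in s -> K x) -> forall x, foldl adjoin J s x -> K x.
Proof.
move=> iK; elim: s J => //= a s IHs J JK sK.
apply: IHs => [x|x xs]; last by apply: sK; rewrite inE xs orbT.
by apply: adjoin_sub => //; apply: sK; rewrite mem_head.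
Qed.

Lemma ideal_in_ideal_gen s : ideal (in_ideal_gen s).
Proof.
split.
- by exists (fun=> 0); rewrite big1 // => i _; rewrite mul0r.
- move=> _ _ [c ->] [d ->]; exists (fun i => c i + d i).
  by rewrite -big_split; apply: eq_bigr => i _; rewrite mulrDl.
- move=> a _ [c ->]; exists (fun i => a * c i).
  by rewrite mulr_sumr; apply: eq_bigr => i _; rewrite mulrA.
Qed.

Lemma in_ideal_genE s x :
  in_ideal_gen s x <-> foldl adjoin (fun y => y = 0) s x.
Proof.
split=> [[c ->]|].
  apply: ideal_sum => [|i _]; first exact/ideal_idspan/ideal_zero.
  apply: ideal_mull; first exact/ideal_idspan/ideal_zero.
  by apply: mem_idspan; [exact: ideal_zero|exact: mem_nth].
apply: idspan_sub => [|_ ->|y /(nthP 0)[i lti <-]].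
- exact: ideal_in_ideal_gen.
- exact: ideal0 (ideal_in_ideal_gen s).
exists (fun j => (j == i)%:R); rewrite (bigD1 (Ordinal lti)) //= eqxx mul1r.
by rewrite big1 ?addr0 // => j; rewrite -val_eqE /= => /negbTE ->; rewrite mul0r.
Qed.

Lemma idealr_closedP (P : {pred R}) :
  idealr_closed P <-> ideal (fun x => x \in P) /\ 1 \notin P.
Proof.
split=> [[P0 P1 Pl]|[iP P1]].
  split=> //; split=> // [x y Px Py|a x Px].
    by have := Pl 1 _ _ Px Py; rewrite mul1r.
  by have := Pl a _ _ Px P0; rewrite addr0.
split=> // [|a x y Px Py]; first exact: ideal0 iP.
by apply: (idealD iP) => //; apply: (ideal_mull _ iP).
Qed.

(* Zorn_bigcup also considers the empty chain, whose union is empty: hence the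
   disjunct X = set0. *)
Lemma prime_avoiding J (S : R -> Prop) : ideal J -> S 1 ->
  (forall x y, S x -> S y -> S (x * y)) -> (forall x, S x -> ~ J x) ->
  exists Q : {pred R}, [/\ is_prime_ideal Q, forall x, J x -> x \in Q
    & forall x, S x -> x \notin Q].
Proof.
move=> iJ S1 SM SJ.
pose good X := [/\ ideal X, forall x, J x -> X x & forall x, S x -> ~ X x].
have [F Fgood Ftot|M [[->|[iM JM SMd]] Mmax]] :=
    @Zorn_bigcup R (fun X => X = set0 \/ good X).
- have [[X FX X0]|FX0] := pselect (exists2 X, F X & X <> set0); last first.
    left; rewrite -subset0 => x [X FX Xx]; apply: FX0; exists X => // X0.
    by move: Xx; rewrite X0.
  have gX Y y : F Y -> Y y -> good Y.
    by move=> /Fgood[Y0|//]; rewrite Y0.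
  have [x0 Xx0] : exists x, X x by apply/set0P/eqP.
  have [iX JX SX] := gX _ _ FX Xx0.
  right; split; last by move=> x Sx [Y FY Yx]; have [_ _ /(_ _ Sx)] := gX _ _ FY Yx.
  + split.
    * by exists X => //; apply: ideal0.
    * move=> x y [Y FY Yx] [Z FZ Zy].
      have [iY _ _] := gX _ _ FY Yx; have [iZ _ _] := gX _ _ FZ Zy.
      have [YZ|ZY] := Ftot _ _ FY FZ.
        by exists Z => //; apply: idealD => //; apply: YZ.
      by exists Y => //; apply: idealD => //; apply: ZY.
    * move=> a x [Y FY Yx]; have [iY _ _] := gX _ _ FY Yx.
      by exists Y => //; apply: ideal_mull.
  + by move=> x Jx; exists X => //; apply: JX.
- case: (Mmax J); last by right; split.
  split=> // J0; have /J0 // := ideal0 iJ.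
have meets a : ~ M a -> exists2 x, S x & adjoin M a x.
  move=> Ma; apply: contrapT => nS; apply: (Mmax (adjoin M a)).
    split=> [x|]; first exact: sub_adjoin.
    by move=> sub; apply/Ma/sub/mem_adjoin.
  right; split; first exact: ideal_adjoin.
    by move=> x /JM; apply: sub_adjoin.
  by move=> x Sx Mx; apply: nS; exists x.
exists (fun x => `[< M x >]); split.
- split.
    apply/idealr_closedP; split; last first.
      by apply/negP => /asboolP; apply: SMd.
    split; first by apply/asboolP; apply: ideal0.
      by move=> x y /asboolP Mx /asboolP My; apply/asboolP; apply: idealD.
    by move=> a x /asboolP Mx; apply/asboolP; apply: ideal_mull.
  move=> u v /asboolP Muv.
  have [Mu|/meets[x Sx [b Mx]]] := pselect (M u).
    by apply/orP; left; apply/asboolP.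
  have [Mv|/meets[y Sy [c My]]] := pselect (M v).
    by apply/orP; right; apply/asboolP.
  (* x y = y (x - b u) + b u (y - c v) + b c u v, a sum of three elements of [M]. *)
  exfalso; apply: (SMd _ (SM _ _ Sx Sy)).
  have := idealD iM (ideal_mull y iM Mx)
    (idealD iM (ideal_mull (b * u) iM My) (ideal_mull (b * c) iM Muv)).
  by congr M; ring.
- by move=> x /JM Mx; apply/asboolP.
- by move=> x Sx; apply/negP => /asboolP; apply: SMd.
Qed.

Fixpoint weakly_regular J s : Prop :=
  if s is a :: s' then
    (forall b, J (b * a) -> J b) /\ weakly_regular (adjoin J a) s'
  else True.

Lemma weakly_regular_eq J K s : (forall x, J x <-> K x) ->
  weakly_regular J s -> weakly_regular K s.
Proof.
elim: s J K => //= a s IHs J K JK [reg wreg].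
split; first by move=> b; rewrite -!JK; apply: reg.
exact: IHs (adjoin_eq a JK) wreg.
Qed.

Lemma weakly_regularP J s : weakly_regular J s <->
  forall i, (i < size s)%N -> forall a,
    foldl adjoin J (take i s) (a * s`_i) -> foldl adjoin J (take i s) a.
Proof.
elim: s J => //= a s IHs J; split=> [[reg /IHs wreg] [_ b|i]|reg] //=.
- exact: reg.
- exact: wreg.
split; first exact: (reg 0%N isT).
by apply/IHs => i; apply: (reg i.+1).
Qed.

(* If x and y are weakly regular modulo (J : x) and J + (x), then so modulo J,
   by the exact sequence 0 -> R/(J : x) -> R/J -> R/(J + (x)) -> 0. *)
Lemma weakly_regular_exact J x s : ideal J ->
  weakly_regular (fun y => J (y * x)) s -> weakly_regular (adjoin J x) s ->
  weakly_regular J s.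
Proof.
elim: s J => //= a s IHs J iJ [colon_a colon_s] [adj_a adj_s]; split.
  move=> b Jba; have /adj_a[c Jc] := sub_adjoin x Jba.
  have /colon_a Jcx : J (c * a * x).
    by have := idealB iJ Jba (ideal_mull a iJ Jc); congr J; ring.
  by have := idealD iJ Jc Jcx; rewrite subrK.
apply: IHs; first exact: ideal_adjoin.
  (* (J : x) + (a) equals (J + (a)) : x. That the second is contained in the first uses the
     regularity of [a] modulo J + (x). *)
  apply: weakly_regular_eq colon_s => y; split=> [[b Jb]|[b Jb]].
    by exists (b * x); have := Jb; congr J; ring.
  have /adj_a[c Jc] : adjoin J x (b * a).
    by exists y; have := idealN iJ Jb; congr J; ring.
  exists c; have := idealD iJ Jb (ideal_mull a iJ Jc); congr J; ring.
apply: weakly_regular_eq adj_s => y; split=> -[b [c Jc]].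
  by exists c, b; have := Jc; congr J; ring.
by exists c, b; have := Jc; congr J; ring.
Qed.

(* For the step from Q(i) down to Q(i-1), avoid the multiplicative set of the
   products of a power of s_i by an element outside Q(i). *)
Lemma regular_prime_chain (P : {pred R}) s :
  is_prime_ideal P -> {subset s <= P} -> regular_sequence s ->
  has_prime_chain P (size s).
Proof.
move=> prP sP [reg _].
have {}reg : weakly_regular (fun x => x = 0) s.
  by apply/weakly_regularP => i lti a /in_ideal_genE/(reg _ lti)/in_ideal_genE.
suff chain J : ideal J -> (forall x, J x -> x \in P) -> weakly_regular J s ->
    exists Q : nat -> {pred R},
    [/\ forall i, (i <= size s)%N -> is_prime_ideal (Q i),
        forall i, (i < size s)%N -> {subset Q i <= Q i.+1} /\ ~ (Q i =i Q i.+1),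
        Q (size s) =i P & forall x, J x -> x \in Q 0%N].
  have P0 x : x = 0 -> x \in P.
    by move=> ->; have [/idealr_closedP[/ideal0]] := prP.
  by have [Q [? ? ? _]] := chain _ ideal_zero P0 reg; exists Q.
elim: s J sP {reg} => [|a s IHs] J sP iJ JP /=; first by move=> _; exists (fun=> P).
case=> reg_a /IHs[||x|Q [prQ ltQ QP JQ]].
- by move=> x xs; apply: sP; rewrite inE xs orbT.
- exact: ideal_adjoin.
- have [/idealr_closedP[iP _] _] := prP.
  by apply: (adjoin_sub iP) => //; apply: sP; rewrite mem_head.
have [/idealr_closedP[iQ Q1] primeQ] := prQ 0%N isT.
pose S x := exists m y, y \notin Q 0%N /\ x = a ^+ m * y.
have S1 : S 1 by exists 0%N, 1; rewrite mul1r.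
have SM x z : S x -> S z -> S (x * z).
  case=> m [y [Qy ->]] [l [w [Qw ->]]].
  exists (m + l)%N, (y * w); split; last by rewrite exprD; ring.
  by apply: contra Qy => /primeQ/orP[//|Qw']; rewrite Qw' in Qw.
have SJ x : S x -> ~ J x.
  case=> m [y [Qy ->]] Jy; move/negP: Qy; apply; apply/JQ/sub_adjoin.
  elim: m Jy => [|m IHm]; first by rewrite mul1r.
  by rewrite exprS -mulrA mulrC => /reg_a.
have [Q0 [prQ0 JQ0 SQ0]] := prime_avoiding iJ S1 SM SJ.
(* [S] contains [a] and the complement of [Q 0], while [a] lies in [Q 0]: hence [Q0] is strictly
   smaller than [Q 0]. *)
have Qa : a \in Q 0%N by apply/JQ/mem_adjoin.
exists (fun i => if i is j.+1 then Q j else Q0); split=> //.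
- by case.
- case=> [|i]; last exact: ltQ.
  split=> [x|eqQ]; last first.
    by have := SQ0 a; rewrite eqQ Qa => /(_ _)/negP; apply=> //;
      exists 1%N, 1; rewrite mulr1.
  by apply: contraTT => Qx; apply: SQ0; exists 0%N, x; rewrite mul1r.
Qed.

End Ideals.

(** * Hilbert's basis theorem and Zariski's lemma *)

Lemma noetherianP (R : comNzRingType) : noetherian R <->
  forall J : R -> Prop, ideal J -> exists s, forall x, J x <-> in_ideal_gen s x.
Proof.
split=> [noethR J iJ|fgR J /idealr_closedP[iJ _]]; last exact: fgR.
have [J1|J1] := pselect (J 1).
  exists [:: 1] => x; split=> [_|_].
    by exists (fun=> x); rewrite big_ord1 mulr1.
  by rewrite -[x]mulr1; apply: ideal_mull.
have [|s genJ] := noethR (fun x => `[< J x >]).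
  apply/idealr_closedP; split; last by apply/negP => /asboolP.
  split; first by apply/asboolP; apply: ideal0.
    by move=> x y /asboolP Jx /asboolP Jy; apply/asboolP; apply: idealD.
  by move=> a x /asboolP Jx; apply/asboolP; apply: ideal_mull.
by exists s => x; rewrite -genJ; split=> [Jx|/asboolP//]; apply/asboolP.
Qed.

Lemma in_ideal_gen_sub (R : comNzRingType) (J : R -> Prop) s : ideal J ->
  (forall x, x \in s -> J x) -> forall x, in_ideal_gen s x -> J x.
Proof.
move=> iJ sJ _ [c ->]; apply: ideal_sum => // i _.
by apply: ideal_mull => //; apply/sJ/mem_nth.
Qed.

Lemma mem_in_ideal_gen (R : comNzRingType) (s : seq R) x :
  x \in s -> in_ideal_gen s x.
Proof. by move=> xs; apply/in_ideal_genE/mem_idspan => //; apply: ideal_zero. Qed.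

Lemma noetherian_surj (R A : comNzRingType) (phi : {rmorphism R -> A}) :
  (forall y, exists x, phi x = y) -> noetherian R -> noetherian A.
Proof.
move=> surj /noetherianP fgR; apply/noetherianP => J iJ.
have [|s sJ] := fgR (fun x => J (phi x)).
  split=> [|x y Jx Jy|a x Jx].
  - by rewrite rmorph0; apply: ideal0.
  - by rewrite rmorphD; apply: idealD.
  - by rewrite rmorphM; apply: ideal_mull.
exists [seq phi x | x <- s] => y; split; last first.
  apply: in_ideal_gen_sub => // _ /mapP[x xs ->].
  by apply/sJ; apply: mem_in_ideal_gen.
have [x <-] := surj y; move/sJ=> [c ->]; rewrite rmorph_sum.
apply: ideal_sum => [|i _]; first exact: ideal_in_ideal_gen.
rewrite rmorphM; apply: ideal_mull; first exact: ideal_in_ideal_gen.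
by apply/mem_in_ideal_gen/map_f/mem_nth.
Qed.

(* L j is the ideal of the coefficients of degree j of the elements of J of
   degree at most j. It increases with j, so it is constant from some d on. *)
Lemma hilbert_basis (R : comNzRingType) : noetherian R -> noetherian {poly R}.
Proof.
move=> /noetherianP fgR; apply/noetherianP => J iJ.
pose L j a := exists f, [/\ J f, (size f <= j.+1)%N & f`_j = a].
have iL j : ideal (L j).
  split.
  - by exists 0; rewrite size_poly0 coef0; split=> //; apply: ideal0.
  - move=> _ _ [f [Jf sf <-]] [g [Jg sg <-]]; exists (f + g).
    rewrite coefD; split=> //; first exact: idealD.
    by apply: leq_trans (size_polyD _ _) _; rewrite geq_max sf.
  - move=> a _ [f [Jf sf <-]]; exists (a *: f).
    rewrite coefZ -mul_polyC; split=> //; first exact: ideal_mull.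
    by rewrite mul_polyC; apply: leq_trans (size_scale_leq _ _) _.
have Lle j l a : (j <= l)%N -> L j a -> L l a.
  move=> lejl [f [Jf sf <-]]; exists ('X^(l - j) * f); split.
  - exact: ideal_mull.
  - rewrite (leq_trans (size_polyMleq _ _)) // size_polyXn addSn /=.
    by rewrite (leq_trans (leq_add (leqnn _) sf)) // addnS subnK.
  - by rewrite coefXnM ltnNge leq_subr /= subKn.
have [|s sL] := fgR (fun a => exists j, L j a).
  split; first by exists 0%N; apply: ideal0.
    move=> x y [j Lx] [l Ly]; exists (maxn j l).
    by apply: idealD => //; [apply: Lle Lx|apply: Lle Ly]; lia.
  by move=> a x [j Lx]; exists j; apply: ideal_mull.
have [d dL] : exists d, forall a, a \in s -> L d a.
  have : forall a, a \in s -> exists j, L j a.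
    by move=> a /mem_in_ideal_gen/sL.
  elim: s {sL} => [|a s IHs] sL; first by exists 0%N.
  have [|d dL] := IHs; first by move=> b bs; apply: sL; rewrite inE bs orbT.
  have [j La] := sL a (mem_head _ _); exists (maxn j d) => b.
  rewrite inE => /predU1P[->|/dL Lb]; first by apply: Lle La; lia.
  by apply: Lle Lb; lia.
have {s sL dL} Ld j a : L j a -> L d a.
  by move=> La; apply: (in_ideal_gen_sub (iL d) dL); apply/sL; exists j.
have [g gL] := choice (fun j => fgR (L j) (iL j)).
have /choice[w wL] j : exists w : R -> {poly R}, forall a, L j a ->
    [/\ J (w a), (size (w a) <= j.+1)%N & (w a)`_j = a].
  have /choice[w wP] a : exists f, L j a ->
      [/\ J f, (size f <= j.+1)%N & f`_j = a].
    have [[f Jf]|nL] := pselect (L j a); first by exists f.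
    by exists 0.
  by exists w.
exists [seq w j a | j <- iota 0 d.+1, a <- g j] => f; split; last first.
  apply: in_ideal_gen_sub => // _ /allpairsPdep[j [a [_ ag ->]]].
  by have [] := wL j a ((gL j a).2 (mem_in_ideal_gen ag)).
set G := flatten _; have iG := ideal_in_ideal_gen G.
have [l] := ubnP (size f); elim: l f => // l IHl f lef Jf.
have [->|f0] := eqVneq f 0; first exact: ideal0.
have [j sf] : exists j, size f = j.+1.
  by exists (size f).-1; rewrite prednK ?size_poly_gt0.
(* Beyond degree [d] the leading coefficient of [f] already lies in [L d], so lifts of degree at
   most [d], shifted by a power of X, suffice to cancel it. *)
pose i := minn j d.
have Li : L i f`_j.
  have Lf : L j f`_j by exists f; rewrite sf.
  by rewrite /i; case: leqP => // _; apply: Ld Lf.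
have [c cE] := (gL _ _).1 Li.
pose h := \sum_(k < size (g i)) ((c k)%:P * 'X^(j - i)) * w i (g i)`_k.
have gLi (k : 'I_(size (g i))) : L i (g i)`_k.
  by apply/gL/mem_in_ideal_gen/mem_nth.
have Gh : in_ideal_gen G h.
  apply: ideal_sum => // k _; apply: ideal_mull => //.
  apply/mem_in_ideal_gen/allpairs_f_dep; last exact: mem_nth.
  by rewrite mem_iota; lia.
have Jh : J h.
  apply: ideal_sum => // k _; apply: ideal_mull => //.
  by have [] := wL i _ (gLi k).
have hj : h`_j = f`_j.
  rewrite coef_sum cE; apply: eq_bigr => k _.
  have [_ _ wk] := wL i _ (gLi k).
  rewrite -mulrA coefCM coefXnM ltnNge leq_subr /= subKn ?geq_minl //.
  by rewrite wk.
have sh : (size h <= j.+1)%N.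
  apply: leq_trans (size_sum _ _ _) _; apply/bigmax_leqP => k _.
  have [_ swk _] := wL i _ (gLi k).
  rewrite -mulrA mul_polyC (leq_trans (size_scale_leq _ _)) //.
  rewrite (leq_trans (size_polyMleq _ _)) // size_polyXn; lia.
rewrite -[f](subrK h); apply: idealD => //; apply: IHl; last exact: idealB.
rewrite -ltnS; apply: leq_trans lef; rewrite sf !ltnS; apply/leq_sizeP => m.
rewrite leq_eqVlt => /predU1P[<-|ltjm]; rewrite coefB; first by rewrite hj subrr.
by rewrite !nth_default ?subr0 //; [apply: leq_trans ltjm|rewrite sf].
Qed.

(** Finite generation as an algebra, in the form of an induction principle: it passes to the base
    ring R[v] without polynomials in several variables. *)
Definition generates (R A : comNzRingType) (phi : R -> A) (u : seq A) :=
  forall P : A -> Prop, (forall r, P (phi r)) -> {in u, forall x, P x} ->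
  (forall x y, P x -> P y -> P (x + y)) ->
  (forall x y, P x -> P y -> P (x * y)) -> forall x, P x.

Definition eval_at (R A : comNzRingType) (phi : {rmorphism R -> A}) (x : A) :
    {rmorphism {poly R} -> A} :=
  horner_morph (fun r => mulrC x (phi r)).

Lemma eval_atC (R A : comNzRingType) (phi : {rmorphism R -> A}) x r :
  eval_at phi x r%:P = phi r.
Proof. exact: horner_morphC. Qed.

Lemma eval_atX (R A : comNzRingType) (phi : {rmorphism R -> A}) x :
  eval_at phi x 'X = x.
Proof. exact: horner_morphX. Qed.

(** Moves the generator [v] into the base ring, for inductions on the number of generators. *)
Lemma generates_eval_at (R A : comNzRingType) (phi : {rmorphism R -> A}) v u u' :
  {subset u <= v :: u'} -> generates phi u -> generates (eval_at phi v) u'.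
Proof.
move=> uu' gen P Pphi Pu PD PM; apply: gen => // [r|x /uu'].
  by rewrite -(eval_atC phi v).
by rewrite inE => /predU1P[->|/Pu//]; rewrite -{1}(eval_atX phi v).
Qed.

Lemma noetherian_generates (R A : comNzRingType) (phi : {rmorphism R -> A}) u :
  noetherian R -> generates phi u -> noetherian A.
Proof.
elim: u R phi => [|v u IHu] R phi noethR gen.
  apply: noetherian_surj noethR => y.
  apply: (gen (fun y => exists x, phi x = y)) => // [r|x z [a <-] [b <-]|].
  - by exists r.
  - by exists (a + b); rewrite rmorphD.
  - by move=> x z [a <-] [b <-]; exists (a * b); rewrite rmorphM.
exact: IHu (hilbert_basis noethR) (generates_eval_at (fun=> id) gen).
Qed.

(** The rational root argument: a monic equation of degree d for the fraction a/q, multiplied by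
    q^d, shows that q divides a^d. *)
Lemma integral_quotient (R K : comNzRingType) (phi : {rmorphism R -> K}) a q y :
  injective phi -> y * phi q = phi a -> integralOver phi y ->
  exists d g, a ^+ d = q * g.
Proof.
move=> inj_phi yq [f mon_f /rootP fy].
have [d sf] : exists d, size f = d.+1.
  by exists (size f).-1; rewrite prednK // size_poly_gt0 monic_neq0.
have fd : f`_d = 1 by move/monicP: mon_f; rewrite lead_coefE sf.
exists d, (- \sum_(i < d) f`_i * a ^+ i * q ^+ (d - i.+1)).
apply/eqP; rewrite mulrN -addr_eq0; apply/eqP/inj_phi; rewrite rmorph0.
rewrite -[RHS](mul0r (phi q ^+ d)) -fy horner_coef.
have -> : size (map_poly phi f) = d.+1.
  by rewrite size_poly_eq ?sf //= fd rmorph1 oner_neq0.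
rewrite big_ord_recr /= coef_map /= fd rmorph1 mul1r mulrDl -exprMn yq addrC.
rewrite rmorphD rmorphXn; congr (_ + _).
rewrite mulr_sumr rmorph_sum mulr_suml; apply: eq_bigr => i _.
rewrite coef_map /= mulrCA -exprS subnSK // !rmorphM !rmorphXn /= -yq.
rewrite exprMn -!mulrA; congr (_ * (_ * _)).
by rewrite -exprD subnKC // ltnW.
Qed.

(** If p has degree d > 0 and leading coefficient a, the equation of v multiplied by a^(d-1) is a
    monic equation for a v. *)
Lemma integral_lead_coef (R K : comNzRingType) (phi : {rmorphism R -> K})
    (p : {poly R}) v :
  p != 0 -> (map_poly phi p).[v] = 0 -> integralOver phi (phi (lead_coef p) * v).
Proof.
move=> p0; set a := lead_coef p.
have [d sp] : exists d, size p = d.+1.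
  by exists (size p).-1; rewrite prednK // size_poly_gt0.
have pd : p`_d = a by rewrite /a lead_coefE sp.
rewrite (@horner_coef_wide _ d.+1); last by rewrite -sp size_poly.
rewrite big_ord_recr /= coef_map /= pd => pv.
(* A constant [p] with a root has [phi a = 0], and X is then a monic equation for [phi a * v]. *)
case: d => [|d] in sp pd pv *.
  exists 'X; first exact: monicX.
  apply/rootP; rewrite map_polyX hornerX.
  by move: pv; rewrite big_ord0 add0r expr0 mulr1 => ->; rewrite mul0r.
pose q := 'X^(d.+1) + \poly_(i < d.+1) (p`_i * a ^+ (d - i)).
exists q.
  by rewrite monicE lead_coefDl ?lead_coefXn // size_polyXn ltnS size_poly.
apply/rootP; rewrite rmorphD /= map_polyXn hornerD hornerXn.
rewrite (@horner_coef_wide _ d.+1 (map_poly _ _)); last first.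
  by apply: leq_trans (size_poly _ _) _; apply: size_poly.
transitivity (phi a ^+ d * (\sum_(i < d.+1) (map_poly phi p)`_i * v ^+ i
   + phi a * v ^+ d.+1)); last by rewrite pv mulr0.
rewrite mulrDr addrC exprMn mulrA -exprSr; congr (_ + _).
rewrite mulr_sumr; apply: eq_bigr => i _.
rewrite !coef_map coef_poly ltn_ord /= rmorphM rmorphXn exprMn.
have -> : phi a ^+ d = phi a ^+ (d - i) * phi a ^+ i.
  by rewrite -exprD subnK // -ltnS.
ring.
Qed.

(* If some generator v is transcendental over R, then R may be replaced by
   R[v], and the element r of R[v] thus obtained is such that 1 + v r divides a
   power of r in R[v], which is absurd. *)
Lemma zariski (R : idomainType) (K : comNzRingType) (phi : {rmorphism R -> K})
    (u : seq K) :
  (forall w : K, w != 0 -> exists w', w' * w = 1) ->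
  injective phi -> generates phi u ->
  exists2 r : R, r != 0 & forall w, exists N, integralOver phi (phi r ^+ N * w).
Proof.
move=> invK; have [m] := ubnP (size u).
elim: m => // m IHm in R phi u *; rewrite ltnS => leum inj_phi gen.
have [alg|] := pselect (forall v, v \in u ->
    exists2 p : {poly R}, p != 0 & (map_poly phi p).[v] = 0).
  have [r r0 ru] : exists2 r, r != 0 &
      forall v, v \in u -> integralOver phi (phi r * v).
    elim: u alg {leum gen} => [|v u IHu] alg; first by exists 1; rewrite ?oner_eq0.
    have [|r r0 ru] := IHu; first by move=> x xu; apply: alg; rewrite inE xu orbT.
    have [p p0 pv] := alg v (mem_head _ _).
    exists (r * lead_coef p); first by rewrite mulf_neq0 ?lead_coef_eq0.
    move=> x; rewrite inE rmorphM => /predU1P[->|/ru intx].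
      by rewrite -mulrA; apply: integral_mul (integral_id _ _) _;
        apply: integral_lead_coef.
    by rewrite mulrAC; apply: integral_mul (integral_id _ _).
  exists r => //.
  have up w N M : (N <= M)%N -> integralOver phi (phi r ^+ N * w) ->
      integralOver phi (phi r ^+ M * w).
    move=> /subnK <- intw; rewrite exprD -mulrA -rmorphXn.
    exact: integral_mul (integral_id _ _) intw.
  apply: gen => [a|v vu|x y [N intx] [M inty]|x y [N intx] [M inty]].
  - by exists 0%N; rewrite mul1r; apply: integral_id.
  - by exists 1%N; apply: ru.
  - exists (N + M)%N; rewrite mulrDr.
    by apply: integral_add; [apply: up intx|apply: up inty]; lia.
  - by exists (N + M)%N; rewrite exprD mulrACA; apply: integral_mul.
move=> /existsNP[v /not_implyP[vu trans]].
have inj_phiv : injective (eval_at phi v).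
  apply: raddf_inj => p pv; apply: contrapT => /eqP p0.
  by apply: trans; exists p.
have [|//||r r0 rP] := IHm {poly R} (eval_at phi v) (rem v u).
- by rewrite size_rem //; case: (u) vu leum.
- by apply: generates_eval_at gen => x; rewrite (perm_mem (perm_to_rem vu)).
have sq : size (1 + 'X * r) = (size r).+1.
  by rewrite addrC size_polyDl mulrC size_mulX // size_poly1 ltnS size_poly_gt0.
have [w wq] : exists w, w * eval_at phi v (1 + 'X * r) = 1.
  by apply: invK; rewrite raddf_eq0 // -size_poly_eq0 sq.
have [N intw] := rP w.
have [|d [g]] := integral_quotient inj_phiv _ intw (q := 1 + 'X * r) (a := (r ^+ N)%R).
  by rewrite -mulrA wq mulr1 rmorphXn.
rewrite -exprM; set M := (N * d)%N => rM.
(* Modulo 1 + X r the element -X r is 1, so 1 + X r, which divides r^M, is a unit of R[X]. Its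
   positive degree contradicts this. *)
have [h hE] : exists h, (- 'X * r) ^+ M = 1 - (1 + 'X * r) * h.
  elim: (M) => [|n [h hn]]; first by exists 0; rewrite mulr0 subr0.
  by exists (1 - 'X * r * h); rewrite exprS hn; ring.
have unit_q : (1 + 'X * r) * ((- 'X) ^+ M * g + h) = 1.
  by rewrite mulrDr mulrCA -rM -exprMn hE subrK.
have /(congr1 (size : {poly R} -> nat)) := unit_q.
rewrite size_poly1 size_mul; first last.
- by apply: contra_eq_neq unit_q => ->; rewrite mulr0 eq_sym oner_neq0.
- by rewrite -size_poly_eq0 sq.
rewrite sq addSn /=.
have : (- 'X) ^+ M * g + h != 0.
  by apply: contra_eq_neq unit_q => ->; rewrite mulr0 eq_sym oner_neq0.
rewrite -!size_poly_gt0 in r0 *; case: (size r) r0 => // a _; case: (size _)=> // b _.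
by rewrite addSn addnS => -[].
Qed.

(** * Regular sequences of parameters in face rings *)

Section ParametricRegularity.
Variables (k : fieldType) (S : comNzRingType) (phi : {rmorphism k -> S}).
Implicit Types (J : S -> Prop) (mu : {rmorphism S -> {poly S}}).

(** The extension of [J] to S[X]. *)
Definition coef_ideal J : {poly S} -> Prop := fun p => forall i, J p`_i.

Lemma ideal_coef_ideal J : ideal J -> ideal (coef_ideal J).
Proof.
move=> iJ; split=> [i|p q Jp Jq i|p q Jq i].
- by rewrite coef0; apply: ideal0.
- by rewrite coefD; apply: idealD.
- by rewrite coefM; apply: ideal_sum => // j _; apply: ideal_mull.
Qed.

(** The leading coefficient of [f] is a unit, so the coefficients of [g] fall into [J] one after the
    other, from the top down. *)
Lemma coef_ideal_mul_unit_lead J (g : {poly S}) (f : {poly k}) :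
  ideal J -> f != 0 -> coef_ideal J (g * map_poly phi f) -> coef_ideal J g.
Proof.
move=> iJ f0 Jgf.
have [d sf] : exists d, size f = d.+1.
  by exists (size f).-1; rewrite prednK // size_poly_gt0.
have fd : f`_d != 0 by rewrite -lead_coef_eq0 lead_coefE sf in f0.
suff Jg l : forall i, (size g <= l + i)%N -> J g`_i.
  by move=> i; apply: (Jg (size g)); rewrite leq_addr.
elim: l => [|l IHl] i lei; first by rewrite nth_default //; apply: ideal0.
have Jgt j : (i < j)%N -> J g`_j by move=> ltij; apply: IHl; lia.
suff Jgi : J (g`_i * phi f`_d).
  have := ideal_mulr (phi (f`_d)^-1) iJ Jgi.
  by rewrite -mulrA -rmorphM mulfV // rmorph1 mulr1.
have lti : (i < (i + d).+1)%N by lia.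
have -> : g`_i * phi f`_d = (g * map_poly phi f)`_(i + d)
    - \sum_(j < (i + d).+1 | j != Ordinal lti) g`_j * (map_poly phi f)`_(i + d - j).
  by rewrite coefM (bigD1 (Ordinal lti)) //= coef_map addKn addrK.
apply: idealB => //; apply: ideal_sum => // j.
rewrite -val_eqE /= => neqj; have [ltij|leji] := ltnP i j.
  by apply: ideal_mulr => //; apply: Jgt.
have -> : (map_poly phi f)`_(i + d - j) = 0.
  by rewrite coef_map /= nth_default ?rmorph0 // sf; lia.
by rewrite mulr0; apply: ideal0.
Qed.

(* mu is a coordinate change which lets t_i move while the t_j with j <> i stay
   put: modulo J, S becomes a polynomial ring in t_i, and in it f_i(t_i) has
   unit leading coefficient. *)
Lemma weakly_regular_parametric J n (t : nat -> S) (f : nat -> {poly k}) :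
  ideal J -> (forall i, (i < n)%N -> f i != 0) ->
  (forall i, (i < n)%N -> exists mu : {rmorphism S -> {poly S}},
     [/\ forall c, mu (phi c) = (phi c)%:P, forall x, (mu x).[t i] = x,
         forall j, (j < n)%N -> mu (t j) = if j == i then 'X else (t j)%:P
       & forall x, J x -> coef_ideal J (mu x)]) ->
  weakly_regular J [seq (map_poly phi (f i)).[t i] | i <- index_iota 0 n].
Proof.
move=> iJ f0 muP; apply/weakly_regularP => i; rewrite size_map size_iota subn0.
move=> lti a.
have [mu [muC muK mut muJ]] := muP i lti.
rewrite (nth_map 0%N) ?size_iota ?subn0 // nth_iota ?subn0 // add0n -map_take.
set L := foldl _ _ _.
have iL : ideal L by apply: ideal_idspan.
have mu_eval g j : mu (map_poly phi g).[t j] =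
    (map_poly (polyC \o phi) g).[mu (t j)].
  rewrite -horner_map; congr (_.[_]).
  by rewrite -map_poly_comp; apply: eq_map_poly => c /=; rewrite muC.
(* The generators of [L] beyond [J] are polynomials in the [t j] with [j < i], which [mu] turns into
   constants. *)
have muL x : L x -> coef_ideal L (mu x).
  have [z0 zD zM] := ideal_coef_ideal iL.
  apply: (@idspan_sub _ J (fun x => coef_ideal L (mu x))) => [|y Jy l|y].
  - split=> [|y z Ly Lz|y z Lz]; first by rewrite rmorph0.
      by rewrite rmorphD; apply: zD.
    by rewrite rmorphM; apply: zM.
  - by apply: sub_idspan; apply: muJ.
  rewrite take_iota => /mapP[j]; rewrite mem_iota => ltj -> l.
  have [ltjn neqji] : (j < n)%N /\ j != i by lia.
  rewrite mu_eval mut // (negbTE neqji) map_poly_comp horner_map /= coefC.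
  case: eqP => _; last exact: ideal0.
  apply: mem_idspan => //; apply/mapP; exists j => //.
  by rewrite take_iota mem_iota.
move=> /muL; rewrite rmorphM mu_eval mut // eqxx.
have -> : (map_poly (polyC \o phi) (f i)).['X] = map_poly phi (f i).
  by rewrite map_poly_comp; apply: comp_polyXr.
move=> /(coef_ideal_mul_unit_lead iL (f0 i lti)) Lmu.
(* Evaluation at [t i] undoes [mu] and brings the conclusion back from S[X] to [S]. *)
by rewrite -(muK a) horner_coef; apply: ideal_sum => // j _; apply: ideal_mulr.
Qed.

End ParametricRegularity.

(** * Face ideals, their colon ideals and their sums with a variable *)

Section StanleyReisner.
Variables (k : fieldType) (T : finType) (V : {set T}).
Local Notation m := #|V|.
Implicit Types (F : pred {set T}) (p : {mpoly k[m]}) (mm : 'X_{1..m}) (i : 'I_m).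

(** Supports are sets of vertices rather than of indices, so that all induced subgraphs share the
    polynomial ring of [V]. *)
Definition supp mm : {set T} := [set enum_val i | i : 'I_m & mm i != 0%N].

Lemma mem_supp mm i : (enum_val i \in supp mm) = (mm i != 0%N).
Proof.
apply/imsetP/idP => [[j]|mi]; last by exists i; rewrite ?inE.
by rewrite inE => mj /enum_val_inj ->.
Qed.

Lemma supp_sub mm : supp mm \subset V.
Proof. by apply/subsetP => _ /imsetP[i _ ->]; apply: enum_valP. Qed.

Lemma suppP mm v : v \in supp mm -> exists2 i, v = enum_val i & mm i != 0%N.
Proof. by case/imsetP => i; rewrite inE; exists i. Qed.

Lemma suppD mm mm' : supp (mm + mm')%MM = (supp mm :|: supp mm').
Proof.
apply/setP => v; rewrite !inE; apply/idP/orP.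
  by move=> /suppP[i ->]; rewrite !mem_supp mnmDE; lia.
by case=> /suppP[i -> mi]; rewrite mem_supp mnmDE; lia.
Qed.

Lemma suppU i : supp U_(i)%MM = [set enum_val i].
Proof.
apply/setP => v; rewrite !inE; apply/idP/eqP => [/suppP[j ->]|->].
  by rewrite mnm1E; case: (eqVneq i j) => [->|].
by rewrite mem_supp mnm1E eqxx.
Qed.

(** Prescribing which monomials may occur, instead of giving generators, lets operations on the
    ideal be read off the predicate [F]. *)
Definition stanley_reisner F p : Prop :=
  forall mm, mm \in msupp p -> ~~ F (supp mm).

Definition down_closed F := forall A B : {set T}, A \subset B -> F B -> F A.

Lemma ideal_stanley_reisner F : down_closed F -> ideal (stanley_reisner F).
Proof.
move=> dF; split=> [mm|p q Ip Iq mm /msuppD_le|a p Ip mm /msuppM_le].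
- by rewrite msupp0.
- by rewrite mem_cat => /orP[/Ip|/Iq].
case/allpairsP => -[m1 m2] /= [_ /Ip m2F ->].
by apply: contra m2F; rewrite suppD; apply: dF; apply: subsetUr.
Qed.

Lemma stanley_reisnerX F mm : stanley_reisner F 'X_[mm] <-> ~~ F (supp mm).
Proof.
split=> [|Fm m']; first by apply; rewrite msuppX mem_head.
by rewrite msuppX inE => /eqP ->.
Qed.

Lemma stanley_reisner_sub F (J : {mpoly k[m]} -> Prop) : ideal J ->
  (forall mm, ~~ F (supp mm) -> J 'X_[mm]) ->
  forall p, stanley_reisner F p -> J p.
Proof.
move=> iJ FJ p Fp; rewrite [p]mpolyE big_seq; apply: ideal_sum => // mm /Fp/FJ.
by rewrite -mul_mpolyC; apply: ideal_mull.
Qed.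

Lemma stanley_reisner_ext F F' : F =1 F' ->
  forall p, stanley_reisner F p <-> stanley_reisner F' p.
Proof. by move=> eqF p; split=> Fp mm /Fp; rewrite eqF. Qed.

(** Multiplication by ['X_i] adds one vertex to every support: the colon ideal is the face ideal of
    the star of this vertex. *)
Lemma stanley_reisner_colon F i p :
  stanley_reisner F (p * 'X_i) <->
  stanley_reisner (fun A => F (enum_val i |: A)) p.
Proof.
split=> Fp mm.
  by move=> mp; rewrite -suppU -suppD; apply: Fp; rewrite (perm_mem (msuppMX _ _)) map_f.
rewrite (perm_mem (msuppMX _ _)) => /mapP[m' /Fp m'F ->].
by rewrite suppD suppU.
Qed.

Lemma divX i mm : mm i != 0%N -> 'X_[mm] = 'X_[mm - U_(i)] * 'X_i :> {mpoly k[m]}.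
Proof. by move=> mi; rewrite -mpolyXD submK // lep1mP. Qed.

(** The corresponding operation on the complex is the deletion of the vertex. *)
Lemma stanley_reisner_adjoin F i p : down_closed F ->
  adjoin (stanley_reisner F) 'X_i p <->
  stanley_reisner (fun A => F A && (enum_val i \notin A)) p.
Proof.
move=> dF; have dF' : down_closed (fun A => F A && (enum_val i \notin A)).
  move=> A B AB /andP[/(dF _ _ AB) -> iB] /=.
  by apply: contra iB; apply: (subsetP AB).
split.
  apply: adjoin_sub; first exact: ideal_stanley_reisner.
    by move=> q Fq mm /Fq/negbTE ->.
  by apply/stanley_reisnerX; rewrite suppU inE eqxx andbF.
have iF : ideal (adjoin (stanley_reisner F) 'X_i).
  exact/ideal_adjoin/ideal_stanley_reisner.
apply: stanley_reisner_sub => // mm; rewrite negb_and negbK => /orP[Fm|].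
  exact/sub_adjoin/stanley_reisnerX.
rewrite mem_supp => /divX ->; apply: ideal_mull => //.
exact/mem_adjoin/ideal_stanley_reisner.
Qed.

End StanleyReisner.

(** * Pure vertex decomposability *)

Section PureVertexDecomposability.
Variables (T : finType) (e : rel T).
Hypotheses (e_sym : ssrbool.symmetric e) (e_irr : irreflexive e).
Implicit Types (A B C W : {set T}) (u v : T).

Local Notation gr W := (Graph W e_sym e_irr).

Definition indep W A : bool :=
  (A \subset W) && [forall x in A, forall y in A, ~~ e x y].

Lemma indepP W A : reflect (A \subset W /\ {in A &, forall x y, ~~ e x y}) (indep W A).
Proof.
apply: (iffP andP) => -[-> eA]; split=> //.
  by move=> x y xA yA; move: eA => /forall_inP/(_ _ xA)/forall_inP/(_ _ yA).
by apply/forall_inP => x xA; apply/forall_inP => y yA; apply: eA.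
Qed.

Lemma down_closed_indep W : down_closed (indep W).
Proof.
move=> A B AB /indepP[BW eB]; apply/indepP; split.
  exact: subset_trans BW.
by move=> x y /(subsetP AB) xB /(subsetP AB); apply: eB.
Qed.

Lemma indep_setU1 W v A : v \in W ->
  indep W (v |: A) = indep (W :\: [set u | e v u]) A.
Proof.
move=> vW; apply/indepP/indepP => -[AW eA]; split.
- apply/subsetP => x xA; rewrite !inE eA ?inE ?eqxx ?xA ?orbT //=.
  by apply: (subsetP AW); rewrite !inE xA orbT.
- by move=> x y xA yA; apply: eA; rewrite !inE ?xA ?yA orbT.
- rewrite subUset sub1set vW /=; apply: subset_trans AW _; exact: subsetDl.
- have ev x : x \in A -> ~~ e v x by move=> /(subsetP AW); rewrite !inE => /andP[].
  move=> x y; rewrite !inE => /predU1P[->|xA] /predU1P[->|yA].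
  + by rewrite e_irr.
  + exact: ev.
  + by rewrite e_sym ev.
  + exact: eA.
Qed.

Lemma indep_setD1 W v A : indep (W :\ v) A = indep W A && (v \notin A).
Proof. by rewrite /indep subsetD1 andbAC. Qed.

(** The index is the common size of the maximal independent sets. The shedding condition is encoded
    in it: independent sets of the link have at most [m] elements, hence are not maximal after the
    deletion of [v], where the size is [m.+1]. *)
Inductive pure_vd : nat -> {set T} -> Prop :=
| pure_vd_edgeless W : indep W W -> pure_vd #|W| W
| pure_vd_shed m W v : v \in W -> pure_vd m.+1 (W :\ v) ->
    pure_vd m (W :\: (v |: [set u | e v u])) -> pure_vd m.+1 W.

Lemma card_maxset_indep m W A :
  pure_vd m W -> maxset (indep W) A -> #|A| = m.
Proof.
move=> pvd; elim: pvd A => {m W} [W WW A /maxsetP[/andP[AW _] maxA]|].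
  by rewrite -(maxA _ WW AW).
move=> m W v vW _ IH1 _ IH2 A /maxsetP[iA maxA].
have [vA|vA] := boolP (v \in A); last first.
  apply: IH1; apply/maxsetP; rewrite indep_setD1 iA vA; split=> // B.
  by rewrite indep_setD1 => /andP[iB _]; apply: maxA.
have eqA : v |: (A :\ v) = A by rewrite setD1K.
rewrite (cardsD1 v) vA add1n; congr _.+1; apply: IH2.
have iE B : indep (W :\: (v |: [set u | e v u])) B =
    indep W (v |: B) && (v \notin B).
  by rewrite setUC -setDDl indep_setD1 indep_setU1.
apply/maxsetP; rewrite iE eqA iA !inE eqxx; split=> // B.
rewrite iE => /andP[iB vB] AB.
have <- : v |: B = A by apply: maxA => //; rewrite -{1}eqA setUS.
by rewrite setU1K.
Qed.

Lemma pure_vd_well_covered m W : pure_vd m W -> well_covered (gr W).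
Proof.
move=> pvd A B maxA maxB.
by rewrite (card_maxset_indep pvd maxA) (card_maxset_indep pvd maxB).
Qed.

Lemma card_indep_leq m W A : pure_vd m W -> indep W A -> (#|A| <= m)%N.
Proof.
move=> pvd /maxset_exists[B maxB AB].
by rewrite -(card_maxset_indep pvd maxB) subset_leq_card.
Qed.

Lemma pure_vd_alpha m W : pure_vd m W -> alpha (gr W) = m.
Proof.
move=> pvd; apply/eqP; rewrite eqn_leq; apply/andP; split.
  by apply/bigmax_leqP => A; apply: card_indep_leq.
have [|A maxA _] := @maxset_exists _ (indep W) set0.
  by apply/indepP; split=> [|x y]; rewrite ?sub0set ?inE.
rewrite -(card_maxset_indep pvd maxA).
by apply: (leq_bigmax_cond (F := fun A : {set T} => #|A|)); case/maxsetP: maxA.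
Qed.

Lemma pure_vd_vertex_decomposable m W : pure_vd m W -> vertex_decomposable (gr W).
Proof.
elim=> {m W} [W /indepP[_ eW]|m W v vW pvd1 IH1 pvd2 IH2].
  by apply: vd_edgeless => x y xW yW; apply: eW.
have eqN : W :\: closed_nbhd (gr W) v = W :\: (v |: [set u | e v u]).
  by apply/setP => x; rewrite !inE /=; case: (x \in W); rewrite ?andbF ?andbT.
have del_N : del (gr W) (closed_nbhd (gr W) v) = gr (W :\: (v |: [set u | e v u])).
  by rewrite -eqN.
apply: (@vd_shedding _ (gr W) v) => //; first by rewrite del_N.
rewrite del_N => A iA; apply/negP => /(card_maxset_indep pvd1) cA.
by have := card_indep_leq pvd2 iA; rewrite cA ltnn.
Qed.

(* Adding to W a set C of isolated vertices turns the link of v into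
   the graph W \ N(v), where v has become isolated. *)
Lemma pure_vd_star_ind n (P : {set T} -> Prop) :
  (forall W, indep W W -> #|W| = n -> P W) ->
  (forall W v, v \in W -> P (W :\ v) -> P (W :\: [set u | e v u]) -> P W) ->
  forall W, pure_vd n W -> P W.
Proof.
move=> P0 PS W0 pvd0.
suff cone m W : pure_vd m W -> forall C, (#|C| + m)%N = n -> [disjoint C & W] ->
    (forall u w, u \in C -> w \in C :|: W -> ~~ e u w) -> P (C :|: W).
  rewrite -[W0]set0U; apply: (cone n) => //; rewrite ?cards0 //.
    by rewrite disjoints_subset sub0set.
  by move=> u w; rewrite inE.
elim=> {m W} [W /indepP[_ eW]|m W v vW _ IH1 _ IH2] C cn dCW eC.
  apply: P0; last by rewrite cardsU disjoint_setI0 // cards0 subn0.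
  apply/indepP; split=> // x y xCW yCW; move: (xCW); rewrite inE => /orP[xC|xW].
    exact: eC.
  move: (yCW); rewrite inE => /orP[yC|yW]; last exact: eW.
  by rewrite e_sym; apply: eC.
have vC : v \notin C by rewrite disjoint_sym in dCW; rewrite (disjointFr dCW).
apply: (PS _ v); first by rewrite inE vW orbT.
  have -> : (C :|: W) :\ v = C :|: W :\ v.
    apply/setP => x; rewrite !inE; have [->|//] := eqVneq x v.
    by rewrite (negbTE vC).
  apply: IH1 => //.
    by apply: disjointWr dCW; apply: subD1set.
  move=> u w uC wCW; apply: eC => //; move: wCW.
  by rewrite !inE => /orP[->//|/andP[_ ->]]; rewrite orbT.
have -> : (C :|: W) :\: [set u | e v u] =
    (v |: C) :|: W :\: (v |: [set u | e v u]).
  apply/setP => x; rewrite !inE; have [->|neq /=] := eqVneq x v.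
    by rewrite e_irr vW orbT.
  have [xC|//] := boolP (x \in C).
  by rewrite e_sym eC // !inE vW orbT.
apply: IH2.
- by rewrite cardsU1 vC add1n addSnnS.
- rewrite disjoints_subset subUset sub1set !inE eqxx /= -disjoints_subset.
  by apply: disjointWr dCW; apply: subsetDl.
- move=> u w; rewrite !inE => /predU1P[->|uC] /orP[/predU1P[->|wC]|].
  + by rewrite e_irr.
  + by rewrite e_sym eC // !inE vW orbT.
  + by rewrite negb_or => /andP[/andP[]].
  + by rewrite eC // !inE vW orbT.
  + by rewrite eC // !inE wC.
  + by case/andP => _ wW; rewrite eC // !inE wW orbT.
Qed.

End PureVertexDecomposability.

(** * Regularity of polynomials in the linear parameters *)

Lemma mpoly_rmorph_ext (m : nat) (R A : comNzRingType)
    (f g : {rmorphism {mpoly R[m]} -> A}) :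
  (forall c, f c%:MP = g c%:MP) -> (forall i, f 'X_i = g 'X_i) -> f =1 g.
Proof.
move=> eqC eqX p; rewrite [p]mpolyE !rmorph_sum; apply: eq_bigr => mm _.
rewrite -mul_mpolyC !rmorphM eqC; congr (_ * _).
rewrite mpolyXE_id !rmorph_prod; apply: eq_bigr => i _.
by rewrite !rmorphXn eqX.
Qed.

Section LinearForms.
Variables (k : fieldType) (T : finType) (V : {set T}) (b : nat -> pred T).
Local Notation m := #|V|.
Local Notation S := {mpoly k[m]}.

Definition parameter (j : nat) : S := \sum_(i < m | b j (enum_val i)) 'X_i.

(** A vector of the coordinate subspace of [W] on which the i-th form is 1 and the others vanish;
    having one for each [i] makes the forms linearly independent on the simplex [W]. *)
Definition dual_vector (W : {set T}) n (i : nat) (c : T -> k) :=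
  (forall u, u \notin W -> c u = 0) /\
  forall j, (j < n)%N -> \sum_(u in V | b j u) c u = (j == i)%:R.

(** The coordinate change is the translation by (X - t_i) c, with c dual to t_i: it sends t_i to X
    and fixes the other forms. It preserves the ideal, generated by the variables outside [W],
    because c vanishes there. *)
Lemma parameter_simplex_regular (e : rel T) (W : {set T}) n (f : nat -> {poly k}) :
  indep e W W -> (forall i, (i < n)%N -> exists c, dual_vector W n i c) ->
  (forall i, (i < n)%N -> f i != 0) ->
  weakly_regular (@stanley_reisner k T V (indep e W))
    [seq (map_poly (@mpolyC m k) (f i)).[parameter i] | i <- index_iota 0 n].
Proof.
move=> /indepP[_ eW] dualW f0; apply: weakly_regular_parametric => // [|i lti].
  by apply: ideal_stanley_reisner; apply: down_closed_indep.
have [c [cW cE]] := dualW i lti.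
set I := stanley_reisner _.
have iI : ideal I by apply/ideal_stanley_reisner/down_closed_indep.
pose h (l : 'I_m) : {poly S} := ('X_l)%:P +
  ((c (enum_val l))%:MP)%:P * ('X - (parameter i)%:P).
pose mu : {rmorphism S -> {poly S}} := mmap (polyC \o @mpolyC m k) h.
have muC a : mu a%:MP = (a%:MP)%:P by rewrite /mu /= mmapC.
have muX l : mu 'X_l = h l by rewrite /mu /= mmapX mmap1U.
exists mu; split=> //.
- apply: (@mpoly_rmorph_ext m k S (horner_eval (parameter i) \o mu) idfun).
    by move=> a; rewrite /= muC /horner_eval hornerC.
  move=> l; rewrite /= muX /horner_eval /h !hornerE.
  by rewrite subrr mulr0 addr0.
- move=> j ltj; rewrite rmorph_sum (eq_bigr _ (fun l _ => muX l)) big_split /=.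
  rewrite -mulr_suml -!rmorph_sum /=.
  have -> : \sum_(l < m | b j (enum_val l)) c (enum_val l) = (j == i)%:R.
    by rewrite -cE // big_enum_val_cond.
  case: eqP => [->|_]; last by rewrite !rmorph0 mul0r addr0.
  by rewrite !rmorph1 mul1r addrC subrK.
have [z0 zD zM] := ideal_coef_ideal iI.
apply: (@stanley_reisner_sub _ _ _ _ (fun p => coef_ideal I (mu p))).
  split; first by rewrite rmorph0.
    by move=> x y; rewrite rmorphD; apply: zD.
  by move=> a x; rewrite rmorphM; apply: zM.
move=> mm nWmm.
have /subsetPn[_ /suppP[l -> ml] lW] : ~~ (supp mm \subset W).
  apply: contra nWmm => sW; apply/indepP; split=> // x y xs ys.
  by apply: eW; apply: (subsetP sW).
rewrite (divX _ ml) rmorphM muX /h cW // !rmorph0 mul0r addr0.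
apply: zM => j; rewrite coefC; case: eqP => _; last exact: ideal0.
apply/stanley_reisnerX/negP => /indepP[/subsetP/(_ (enum_val l))].
by rewrite suppU inE eqxx => /(_ isT) lW'; rewrite lW' in lW.
Qed.

(** The induction on stars and deletions ends at independent sets of [n] elements. By purity these
    are maximal in [V] itself, so dual vectors on the facets of [V] suffice. *)
Lemma parameter_regular (e : rel T) n (f : nat -> {poly k}) :
  ssrbool.symmetric e -> irreflexive e -> pure_vd e n V ->
  (forall W, maxset (indep e V) W ->
     forall i, (i < n)%N -> exists c, dual_vector W n i c) ->
  (forall i, (i < n)%N -> f i != 0) ->
  weakly_regular (@stanley_reisner k T V (indep e V))
    [seq (map_poly (@mpolyC m k) (f i)).[parameter i] | i <- index_iota 0 n].
Proof.
move=> e_sym e_irr pvd dualW f0; set s := [seq _ | _ <- _].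
suff reg W : pure_vd e n W -> W \subset V ->
    weakly_regular (@stanley_reisner k T V (indep e W)) s by apply: reg.
move=> {}pvdW; apply: (pure_vd_star_ind e_sym e_irr
  (P := fun W => W \subset V -> weakly_regular (@stanley_reisner k T V (indep e W)) s))
  pvdW => {}W.
  move=> iW cW WV; apply: parameter_simplex_regular => // i lti.
  have iVW : indep e V W by case/indepP: iW => _ eW; apply/indepP.
  apply: dualW lti; apply/maxsetP; split=> // B iB WB; apply/eqP.
  by rewrite eq_sym eqEcard WB cW (card_indep_leq e_sym e_irr pvd iB).
move=> v vW regD regN WV; have vV := subsetP WV v vW.
rewrite -(enum_rankK_in vV vV) in vW regD regN.
set i := enum_rank_in vV v in vW regD regN.
have dW := @down_closed_indep _ e W.
apply: (@weakly_regular_exact _ _ 'X_i); first exact: ideal_stanley_reisner.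
  apply: weakly_regular_eq (regN (subset_trans (subsetDl _ _) WV)) => p.
  rewrite stanley_reisner_colon; apply: stanley_reisner_ext => A.
  by rewrite indep_setU1.
apply: weakly_regular_eq (regD (subset_trans (subD1set _ _) WV)) => p.
rewrite stanley_reisner_adjoin //; apply: stanley_reisner_ext => A.
by rewrite indep_setD1.
Qed.

End LinearForms.

(** * The dimension of a face ring *)

Section ChainFreeness.
Variables (k : fieldType) (A : comNzRingType) (phi : {rmorphism k -> A}).

Definition free_mod (Q : {pred A}) (I : finType) (g : I -> A) :=
  forall c : I -> k, \sum_i phi (c i) * g i \in Q -> forall i, c i = 0.

(** In a relation modulo Q, the lowest power of x cancels, Q being prime and x outside it. Modulo
    Q', which contains x, only the coefficient of that power remains, and the freeness of [g] kills
    it. *)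
Lemma free_mod_powers (Q Q' : {pred A}) (I : finType) (g : I -> A) x D :
  is_prime_ideal Q -> is_prime_ideal Q' -> {subset Q <= Q'} ->
  x \in Q' -> x \notin Q -> free_mod Q' g ->
  free_mod Q (fun ia : I * 'I_D => g ia.1 * x ^+ ia.2).
Proof.
move=> [/idealr_closedP[iQ Q1] prQ] [/idealr_closedP[iQ' _] _] QQ' Q'x Qx free c.
pose h (a : 'I_D) := \sum_i phi (c (i, a)) * g i.
have -> : \sum_ia phi (c ia) * (g ia.1 * x ^+ ia.2) = \sum_a h a * x ^+ a.
  transitivity (\sum_i \sum_(a < D) phi (c (i, a)) * (g i * x ^+ a)).
    by rewrite pair_bigA; apply: eq_bigr => -[].
  rewrite exchange_big; apply: eq_bigr => a _; rewrite mulr_suml.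
  by apply: eq_bigr => i _; rewrite mulrA.
move=> Qsum; suff c0 n : forall a : 'I_D, (a < n)%N -> forall i, c (i, a) = 0.
  by case=> i a; apply: (c0 a.+1).
elim: n => // n IHn a; rewrite ltnS leq_eqVlt => /predU1P[an|]; last exact: IHn.
have h0 (a' : 'I_D) : (a' < a)%N -> h a' = 0.
  by rewrite an => lta; apply: big1 => i _; rewrite IHn // rmorph0 mul0r.
pose y := \sum_(a' < D | (a < a')%N) h a' * x ^+ (a' - a.+1).
have : x ^+ a * (h a + y * x) \in Q.
  move: Qsum; rewrite (bigD1 a) //= (bigID (fun a' : 'I_D => a < a')%N) /=.
  rewrite [X in _ + (_ + X)]big1 ?addr0; last first.
    move=> a' /andP[neq]; rewrite -leqNgt leq_eqVlt val_eqE (negbTE neq) /=.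
    by move=> /h0 ->; rewrite mul0r.
  congr (_ \in Q); rewrite mulrDr mulrC; congr (_ + _).
  rewrite mulrA mulr_sumr mulr_suml; apply: eq_big => [a'|a' /andP[_ lta]].
    by case: (ltnP a a') => [lta|]; rewrite ?andbF // -val_eqE /= neq_ltn lta orbT.
  have -> : x ^+ a' = x ^+ a.+1 * x ^+ (a' - a.+1) by rewrite -exprD subnKC.
  by rewrite exprS; ring.
have Qxa : x ^+ a \notin Q.
  elim: (nat_of_ord a) => [|l IHl]; first by rewrite expr0.
  by rewrite exprS; apply/negP => /prQ; rewrite (negbTE Qx) (negbTE IHl).
move=> /prQ; rewrite (negbTE Qxa) /= => /QQ' Q'h.
by apply: free; have := idealB iQ' Q'h (ideal_mull y iQ' Q'x); rewrite addrK.
Qed.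

(* E N x: x has degree at most N. *)
Lemma prime_chain_free (E : nat -> A -> Prop) r (Q : nat -> {pred A}) :
  E 0%N 1 -> (forall N M x y, E N x -> E M y -> E (N + M)%N (x * y)) ->
  (forall N M x, (N <= M)%N -> E N x -> E M x) -> (forall x, exists N, E N x) ->
  (forall i, (i <= r)%N -> is_prime_ideal (Q i)) ->
  (forall i, (i < r)%N -> {subset Q i <= Q i.+1} /\ ~ (Q i =i Q i.+1)) ->
  exists d, forall D, exists (I : finType) (g : I -> A),
    [/\ #|I| = (D ^ r)%N, free_mod (Q 0%N) g & forall i, E (d * D)%N (g i)].
Proof.
move=> E1 Emul Ele Efin; elim: r Q => [|r IHr] Q prQ ltQ.
  exists 0%N => D; exists unit, (fun=> 1); split=> //; first by rewrite card_unit.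
  have [/idealr_closedP[iQ Q1] _] := prQ 0%N isT.
  move=> c; rewrite (big_pred1 tt) => [|[]//]; rewrite mulr1 => Qc [].
  apply: contraNeq Q1 => c0; have := ideal_mull (phi (c tt)^-1) iQ Qc.
  by rewrite -rmorphM mulVf // rmorph1.
have [d IHd] := IHr (fun i => Q i.+1) (fun i => prQ i.+1) (fun i => ltQ i.+1).
have [QQ' neqQ] := ltQ 0%N isT.
have [x Q'x Qx] : exists2 x, x \in Q 1%N & x \notin Q 0%N.
  apply: contrapT => nex; apply: neqQ => x; apply/idP/idP => [/QQ'//|Q'x].
  by apply: contrapT => /negP Qx; apply: nex; exists x.
have [N EN] := Efin x.
(* A product of [g i], of degree at most d D, and of x^a with a < D has degree at most (d + N) D. *)
exists (d + N)%N => D; have [I [g [cI free Eg]]] := IHd D.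
exists (I * 'I_D)%type, (fun ia : I * 'I_D => g ia.1 * x ^+ ia.2); split.
- by rewrite card_prod card_ord cI expnSr.
- by apply: free_mod_powers free => //; apply: prQ.
case=> i a; rewrite mulnDl; apply: (Emul _ _ _ _ (Eg i)) => /=.
apply: (@Ele (N * a)%N); first by rewrite leq_mul2l ltnW ?orbT.
elim: (nat_of_ord a) => [|l IHl]; first by rewrite muln0.
by rewrite exprS mulnS; apply: Emul.
Qed.

End ChainFreeness.

(** * Counting face monomials to bound the height *)

Section FaceCount.
Variables (k : fieldType) (T : finType) (V : {set T}) (F : pred {set T}) (n : nat).
Hypothesis F_card : forall A : {set T}, F A -> (#|A| <= n)%N.
Local Notation m := #|V|.

Lemma card_supp (mm : 'X_{1..m}) : #|supp mm| = #|[set i | mm i != 0%N]|.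
Proof. by rewrite card_imset //; apply: enum_val_inj. Qed.

Definition bounded_mnm N (x : {ffun 'I_m -> 'I_N.+1}) : 'X_{1..m} :=
  [multinom nat_of_ord (x i) | i < m].

Definition bounded_faces N := [set x : {ffun 'I_m -> 'I_N.+1} | F (supp (bounded_mnm x))].

(** There are at most 2^m supports, and on each of them at most n exponents to choose, with N + 1
    values at most. *)
Lemma card_bounded_faces N : (#|bounded_faces N| <= 2 ^ m * N.+1 ^ n)%N.
Proof.
pose nz (x : {ffun 'I_m -> 'I_N.+1}) := [set i | x i != ord0].
rewrite -sum1_card (partition_big nz (fun B => #|B| <= n)%N) => [|x]; last first.
  rewrite inE => /F_card; rewrite card_supp; congr (_ <= _)%N.
  by apply: eq_card => i; rewrite !inE mnmE -val_eqE.
apply: (@leq_trans (\sum_(B : {set 'I_m} | (#|B| <= n)%N) N.+1 ^ n)).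
  apply: leq_sum => B cB; rewrite sum1_card.
  apply: (@leq_trans #|pffun_on (@ord0 N) (mem B) predT|).
    apply: subset_leq_card; apply/fintype.subsetP => x.
    rewrite inE => /andP[_ /eqP <-]; apply/pffun_onP; split=> //.
    by apply/fintype.subsetP => i; rewrite !inE.
  rewrite card_pffun_on; apply: (@leq_trans (N.+1 ^ #|B|)).
    by rewrite leq_eqVlt; apply/orP; left; apply/eqP; congr (_ ^ _)%N;
      rewrite -[RHS]card_ord; apply: eq_card.
  by rewrite leq_pexp2l.
rewrite sum_nat_const leq_mul2r; apply/orP; right.
apply: leq_trans (max_card _) _.
by rewrite -cardsT -powersetT card_powerset cardsT card_ord.
Qed.

(** A linear combination of the lifts whose coefficients at all face monomials vanish lies in the
    face ideal and dies in [A]; by freeness it is trivial, so the coefficient matrix has independent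
    rows. The bound [N.+1] on [msize] means degree at most [N]. *)
Lemma card_free_mod_stanley_reisner (A : comNzRingType)
    (pi : {rmorphism {mpoly k[m]} -> A}) N (Q : {pred A}) (I : finType) (g : I -> A) :
  is_prime_ideal Q -> (forall p, stanley_reisner F p -> pi p = 0) ->
  (forall i, exists2 p, g i = pi p & (msize p <= N.+1)%N) ->
  free_mod (pi \o @mpolyC m k) Q g -> (#|I| <= 2 ^ m * N.+1 ^ n)%N.
Proof.
move=> [/idealr_closedP[iQ _] _] piF gE free.
apply: leq_trans _ (card_bounded_faces N).
have /choice[q qP] i : exists p, g i = pi p /\ (msize p <= N.+1)%N.
  by have [p] := gE i; exists p.
pose B := bounded_faces N.
pose M := \matrix_(i < #|I|, j < #|B|)
   (q (enum_val i))@_(bounded_mnm (enum_val j)).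
suff : row_free M by rewrite -row_leq_rank => /leq_trans; apply; apply: rank_leq_col.
rewrite -kermx_eq0; apply: contraT => /rowV0Pn[u uM u0].
pose p := \sum_i u 0 (enum_rank i) *: q i.
have Fp : stanley_reisner F p.
  move=> mm mp; apply: contraL mp => Fmm; rewrite -mcoeff_eq0.
  have [degmm|degmm] := ltnP N (mdeg mm).
    rewrite raddf_sum big1 // => i _; rewrite /= mcoeffZ.
    rewrite (memN_msupp_eq0 (p := q i)) ?mulr0 //; apply: msize_mdeg_ge.
    by apply: leq_trans degmm; apply: (qP i).2.
  pose x : {ffun 'I_m -> 'I_N.+1} := [ffun i => inord (mm i)].
  have xE : bounded_mnm x = mm.
    apply/mnmP => i; rewrite mnmE ffunE inordK // ltnS.
    by apply: leq_trans degmm; rewrite mdegE (bigD1 i) //= leq_addr.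
  have Bx : x \in B by rewrite inE xE.
  have /matrixP/(_ 0 (enum_rank_in Bx x)) := sub_kermxP uM.
  rewrite !mxE => sum0; apply/eqP; rewrite raddf_sum -[RHS]sum0.
  rewrite (reindex (@enum_val _ I)) /=; last first.
    by apply: onW_bij; apply: enum_val_bij.
  apply: eq_bigr => i _; rewrite /= mcoeffZ enum_valK mxE.
  by rewrite enum_rankK_in // xE.
have c0 : forall i, u 0 (enum_rank i) = 0.
  apply: free; rewrite (eq_bigr (fun i => pi (u 0 (enum_rank i) *: q i))).
    by rewrite -rmorph_sum piF //; apply: (ideal0 iQ).
  by move=> i _; rewrite /= (qP i).1 -rmorphM mul_mpolyC.
case/eqP: u0; apply/rowP => i; rewrite mxE -(c0 (enum_val i)).
by rewrite enum_valK.
Qed.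

(* A chain of length n+1 would yield D^(n+1) independent elements of degree at
   most d D, among O(D^n) face monomials. *)
Lemma stanley_reisner_height (A : comNzRingType)
    (pi : {rmorphism {mpoly k[m]} -> A}) (P : {pred A}) r :
  (forall x, exists p, pi p = x) -> (forall p, stanley_reisner F p -> pi p = 0) ->
  has_prime_chain P r -> (r <= n)%N.
Proof.
move=> pi_surj piF [Q [prQ ltQ _]]; rewrite leqNgt; apply/negP => ltnr.
pose E N x := exists2 p, x = pi p & (msize p <= N.+1)%N.
have [||||i lei|i lti|d dP] := @prime_chain_free k A (pi \o @mpolyC m k) E n.+1 Q.
- by exists 1; rewrite ?rmorph1 ?msize1.
- move=> N M _ _ [p -> sp] [q -> sq]; exists (p * q); first by rewrite rmorphM.
  apply/bigmax_leqP_seq => mm /msuppM_le/allpairsP[[m1 m2] /= [m1p m2q ->]] _.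
  rewrite mdegD; have := msize_mdeg_lt m1p; have := msize_mdeg_lt m2q; lia.
- by move=> N M x leNM [p -> sp]; exists p => //; apply: leq_trans sp _.
- move=> x; have [p <-] := pi_surj x; exists (msize p), p => //.
- by apply: prQ; apply: leq_trans ltnr.
- by apply: ltQ; apply: leq_trans ltnr.
(* Since d D + 1 <= (d + 1) D, there are at most 2^m (d + 1)^n D^n face monomials, which is less
   than D^(n+1) for this D. *)
pose D := (2 ^ m * d.+1 ^ n).+1.
have [I [g [cI free gE]]] := dP D.
have := card_free_mod_stanley_reisner (prQ 0%N isT) piF gE free.
rewrite cI leqNgt => /negP; apply.
apply: (@leq_ltn_trans (2 ^ m * (d.+1 * D) ^ n)).
  rewrite leq_mul2l; apply/orP; right; case: (posnP n) => [->//|n0].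
  by rewrite leq_exp2r // mulSn addnC -addn1 leq_add2l.
rewrite expnMn mulnA expnS ltn_pmul2r ?expn_gt0 //.
Qed.

End FaceCount.

(** * Cohen-Macaulay edge rings *)

Lemma ideal_quotient (R : comNzRingType) (I : {pred R}) : idealr_closed I ->
  exists (K : comNzRingType) (pi : {rmorphism R -> K}),
    (forall y, exists x, pi x = y) /\ forall x, pi x = 0 <-> x \in I.
Proof.
move=> clI; pose I' : idealr R := HB.pack I (isIdealr.Build R I clI).
exists {ideal_quot I'}, \pi_({ideal_quot I'}); split=> [y|x].
  by exists (repr y); apply: reprK.
have -> : (x \in I) = (x - 0 \in I') by rewrite subr0.
rewrite Quotient.idealrBE; split=> [pix|/eqP pix]; last by rewrite [LHS]pix [LHS]rmorph0.
by apply/eqP; rewrite [LHS]pix [RHS]rmorph0.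
Qed.

Lemma noetherian_field (k : fieldType) : noetherian k.
Proof.
move=> J /idealr_closedP[iJ J1]; exists [::] => x; split=> [Jx|[c ->]].
  exists (fun=> 0); rewrite big_ord0; apply: contraNeq J1 => x0.
  by rewrite -(mulVf x0); apply: (ideal_mull _ iJ).
by rewrite big_ord0; apply: (ideal0 iJ).
Qed.

Lemma maximal_ideal_prime (A : comNzRingType) (P : {pred A}) :
  is_maximal_ideal P -> is_prime_ideal P.
Proof.
move=> [clP maxP]; have [iP P1] := (idealr_closedP P).1 clP.
have [//|_ _ -> ->|x ->|Q [prQ PQ _]] := prime_avoiding iP (S := fun x => x = 1).
- by rewrite mulr1.
- exact/negP.
suff <- : Q = P by [].
by apply: funext => x; apply: (maxP Q prQ.1 PQ).
Qed.

Lemma maximal_ideal_inverse (A : comNzRingType) (P : {pred A}) x :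
  is_maximal_ideal P -> x \notin P -> exists y, 1 - y * x \in P.
Proof.
move=> [clP maxP] Px; have [iP P1] := (idealr_closedP P).1 clP.
apply: contrapT => nex; move/negP: Px; apply.
have iJ := ideal_adjoin x iP.
rewrite -(maxP (fun z => `[< adjoin (fun y => y \in P) x z >])).
- by apply/asboolP; apply: mem_adjoin.
- apply/idealr_closedP; split; last by apply/negP => /asboolP.
  split; first by apply/asboolP; apply: ideal0.
    by move=> y z /asboolP Jy /asboolP Jz; apply/asboolP; apply: idealD.
  by move=> a z /asboolP Jz; apply/asboolP; apply: ideal_mull.
- by move=> z Pz; apply/asboolP; apply: sub_adjoin.
Qed.

Lemma weakly_regular_surj (R A : comNzRingType) (pi : {rmorphism R -> A})
    (J : R -> Prop) (K : A -> Prop) s :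
  (forall y, exists x, pi x = y) -> (forall x, K (pi x) <-> J x) ->
  weakly_regular J s -> weakly_regular K [seq pi x | x <- s].
Proof.
move=> surj; elim: s J K => //= a s IHs J K KJ [reg_a reg_s]; split.
  by move=> b; have [x <-] := surj b; rewrite -rmorphM !KJ; apply: reg_a.
apply: IHs reg_s => x; split=> -[b Jb].
  have [c bc] := surj b; exists c; apply/KJ.
  by rewrite rmorphB rmorphM bc.
by exists (pi b); rewrite -rmorphM -rmorphB; apply/KJ.
Qed.

Section EdgeRing.
Variables (k : fieldType) (T : finType) (G : graph T).
Local Notation V := (vertices G).
Local Notation m := #|V|.
Local Notation e := (@adj T G).

Lemma edge_ideal_stanley_reisner (p : {mpoly k[m]}) :
  p \in @edge_ideal k T G <-> stanley_reisner (indep e V) p.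
Proof.
have iI : ideal (@stanley_reisner k T V (indep e V)).
  by apply: ideal_stanley_reisner; apply: down_closed_indep.
split=> [/asboolP Ip|Ip].
  apply: (in_ideal_gen_sub iI _ Ip) => _ /mapP[[i j] + ->].
  rewrite mem_enum inE /= => eij; rewrite -mpolyXD.
  apply/stanley_reisnerX/negP => /indepP[_ /(_ (enum_val i) (enum_val j))].
  by rewrite suppD !suppU !inE !eqxx orbT eij => /(_ isT isT).
apply/asboolP; move: p Ip.
apply: stanley_reisner_sub; first exact: ideal_in_ideal_gen.
move=> mm /indepP nind.
have [_ /suppP[i -> mi] [_ /suppP[j -> mj] eij]] :
    exists2 x, x \in supp mm & exists2 y, y \in supp mm & e x y.
  apply: contrapT => nex; apply: nind; split=> [|x y xs ys]; first exact: supp_sub.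
  by apply/negP => exy; apply: nex; exists x => //; exists y.
(* As there are no loops, division by ['X_i] leaves the exponent of ['X_j] nonzero. *)
have neqij : i != j by apply: contraTneq eij => ->; rewrite adj_irr.
rewrite (divX _ mi) (@divX _ _ _ j); last first.
  by rewrite mnmBE mnm1E (negbTE neqij) subn0.
rewrite -mulrA; apply: ideal_mull; first exact: ideal_in_ideal_gen.
apply: mem_in_ideal_gen; apply/mapP; exists (j, i) => //.
by rewrite mem_enum inE adj_sym.
Qed.

Lemma cohen_macaulay_face_ring (A : comNzRingType)
    (pi : {rmorphism {mpoly k[m]} -> A}) n (b : nat -> pred T) :
  (forall y, exists x, pi x = y) ->
  (forall p, pi p = 0 <-> stanley_reisner (indep e V) p) ->
  pure_vd e n V ->
  (forall W, maxset (indep e V) W -> forall i, (i < n)%N ->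
     exists c : T -> k, dual_vector V b W n i c) ->
  cohen_macaulay_ring A.
Proof.
move=> pi_surj pi0 pvd dualW.
pose phi : {rmorphism k -> A} := pi \o @mpolyC m k.
pose u := [seq pi 'X_i | i <- enum 'I_m].
have gen_u : generates phi u.
  move=> Q Qphi Qu QD QM x; have [p <-] := pi_surj x; rewrite [p]mpolyE rmorph_sum.
  apply: (big_ind Q) => // [|mm _]; first by rewrite -(rmorph0 phi).
  rewrite -mul_mpolyC rmorphM; apply: (QM); first exact: Qphi.
  rewrite mpolyXE_id rmorph_prod; apply: (big_ind Q) => // [|i _].
    by rewrite -(rmorph1 phi).
  rewrite rmorphXn; elim: (mm i) => [|l IHl]; first by rewrite expr0 -(rmorph1 phi).
  rewrite exprS; apply: (QM) => //; apply: Qu; apply/mapP; exists i => //.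
  by rewrite mem_enum.
have height (P : {pred A}) r : has_prime_chain P r -> (r <= n)%N.
  have indep_card B : indep e V B -> (#|B| <= n)%N.
    exact: card_indep_leq (@adj_sym _ G) (@adj_irr _ G) _ _ _ pvd.
  exact: (stanley_reisner_height indep_card pi_surj (fun p => (pi0 p).2)).
split; first exact: noetherian_generates (@noetherian_field k) gen_u.
move=> P maxP; have prP := maximal_ideal_prime maxP.
have [iP P1] := (idealr_closedP P).1 prP.1.
have [K [pi' [pi'_surj pi'P]]] := ideal_quotient prP.1.
pose phi' : {rmorphism k -> K} := pi' \o phi.
have invK (w : K) : w != 0 -> exists w', w' * w = 1.
  have [x <-] := pi'_surj w => x0.
  have [|y Py] := @maximal_ideal_inverse _ _ x maxP.
    by apply: contraNN x0 => /pi'P/eqP.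
  exists (pi' y); rewrite -rmorphM -(rmorph1 pi'); apply/eqP.
  by rewrite eq_sym -subr_eq0 -rmorphB; apply/eqP/pi'P.
have gen_u' : generates phi' [seq pi' x | x <- u].
  move=> Q Qphi Qu QD QM x; have [y <-] := pi'_surj x.
  apply: (gen_u (fun y => Q (pi' y))) => // [z zu|z t|z t].
  - by apply/Qu/map_f.
  - by rewrite rmorphD; apply: QD.
  - by rewrite rmorphM; apply: QM.
have [r r0 rP] := zariski invK (fmorph_inj phi') gen_u'.
(* Over a field the denominator [r] of Zariski's lemma is invertible, so [K] is integral over
   [k]. *)
have alg (w : K) : exists2 f : {poly k}, f != 0 & (map_poly phi' f).[w] = 0.
  have [N intw] := rP w.
  have [f mon_f /rootP fw] : integralOver phi' w.
    have := integral_mul (integral_id phi' (r ^+ N)^-1) intw.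
    by rewrite -rmorphXn mulrA -rmorphM mulVf ?expf_neq0 // rmorph1 mul1r.
  by exists f => //; apply: monic_neq0.
have /choice[f fP] i : exists f : {poly k}, f != 0 /\
    (map_poly phi' f).[pi' (pi (parameter k V b i))] = 0.
  by have [f] := alg (pi' (pi (parameter k V b i))); exists f.
have := parameter_regular (adj_sym G) (adj_irr G) pvd dualW (fun i _ => (fP i).1).
set s := [seq _ | i <- index_iota 0 n] => reg_s.
have Ps : {subset [seq pi x | x <- s] <= P}.
  move=> _ /mapP[_ /mapP[i _ ->] ->]; apply/pi'P.
  by rewrite -!horner_map -!map_poly_comp; apply: (fP i).2.
have size_s : size [seq pi x | x <- s] = n by rewrite !size_map size_iota subn0.
have reg_pis : regular_sequence [seq pi x | x <- s].
  split; last first.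
    move=> /(in_ideal_gen_sub iP) P1'; move/negP: P1; apply.
    by apply: P1' => x; apply: Ps.
  have /weakly_regularP reg :=
    weakly_regular_surj (K := fun x => x = 0) pi_surj pi0 reg_s.
  by move=> i lti a; rewrite !in_ideal_genE; apply: reg.
exists n; split; split.
- by rewrite -[X in has_prime_chain _ X]size_s; apply: regular_prime_chain.
- by move=> l; apply: height.
- by exists [seq pi x | x <- s].
- by move=> l [t [<- Pt reg_t]]; apply: height (regular_prime_chain prP Pt reg_t).
Qed.

Theorem pure_vd_cohen_macaulay n (b : nat -> pred T) :
  pure_vd e n V ->
  (forall W, maxset (indep e V) W -> forall i, (i < n)%N ->
     exists c : T -> k, dual_vector V b W n i c) ->
  cohen_macaulay_graph k G.
Proof.
pose pi : {rmorphism {mpoly k[m]} -> {ideal_quot @edge_ideal k T G}} :=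
  \pi_({ideal_quot @edge_ideal k T G}).
apply: (cohen_macaulay_face_ring (pi := pi)) => [y|p].
  by exists (repr y); apply: reprK.
rewrite -edge_ideal_stanley_reisner.
have -> : (p \in @edge_ideal k T G) = (p - 0 \in @edge_ideal k T G).
  by rewrite subr0.
rewrite Quotient.idealrBE; split=> [pip|/eqP pip]; last by rewrite [LHS]pip [LHS]rmorph0.
by apply/eqP; rewrite [LHS]pip [RHS]rmorph0.
Qed.

End EdgeRing.

(** * The graphs G_n and H_n *)

Local Close Scope quotient_scope.
Local Close Scope ring_scope.

(** Forming a cone with apex [v] keeps the shedding order and adds one vertex to every facet. *)
Lemma pure_vd_isolated (T : finType) (e : rel T) m (W : {set T}) v :
  ssrbool.symmetric e -> irreflexive e -> pure_vd e m W -> v \notin W ->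
  {in W, forall u, ~~ e v u} -> pure_vd e m.+1 (v |: W).
Proof.
move=> e_sym e_irr; elim=> {m W} [W /indepP[_ eW]|m W w wW _ IH1 _ IH2] vW ev.
  have <- : #|v |: W| = #|W|.+1 by rewrite cardsU1 vW.
  apply: pure_vd_edgeless; apply/indepP; split=> // x y.
  rewrite !inE => /predU1P[->|xW] /predU1P[->|yW]; rewrite ?e_irr ?ev //.
    by rewrite e_sym ev.
  exact: eW.
have vw : v != w by apply: contraNneq vW => ->.
apply: (@pure_vd_shed _ _ _ _ w); first by rewrite inE wW orbT.
  have -> : (v |: W) :\ w = v |: (W :\ w).
    apply/setP => x; rewrite !inE; have [->|_ //] := eqVneq x v.
    by rewrite vw.
  apply: IH1; first by rewrite inE (negbTE vW) andbF.
  by move=> u; rewrite inE => /andP[_]; apply: ev.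
have -> : (v |: W) :\: (w |: [set u | e w u]) = v |: W :\: (w |: [set u | e w u]).
  apply/setP => x; rewrite !inE; have [->|_ //] := eqVneq x v.
  by rewrite (negbTE vw) e_sym (negbTE (ev _ wW)).
apply: IH2; first by rewrite inE (negbTE vW) andbF.
by move=> u; rewrite inE => /andP[_]; apply: ev.
Qed.

(* In G_n, x_i and x_(i+1) are adjacent for all i; the other edges are the
   x_(3k-2) x_(3k+2) and the x_(3l-3) x_(3l). *)
Definition adj_lt (i j : nat) : bool :=
  [|| j == i.+1, (j == i + 4) && (i %% 3 == 1) | (j == i + 3) && (i %% 3 == 0)].

Definition adj_nat (i j : nat) : bool := adj_lt i j || adj_lt j i.

Lemma adj_natC i j : adj_nat i j = adj_nat j i.
Proof. exact: orbC. Qed.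

Lemma adj_nat_irr i : adj_nat i i = false.
Proof. by rewrite /adj_nat /adj_lt; lia. Qed.

(** In this range both have the neighbours 3m - 1 and, when it is positive, 3m - 3; hence x_(3m) can
    stand in for x_(3m-2). *)
Lemma adj_nat_relabel m j : 0 < j < 3 * m -> j != 3 * m - 2 ->
  adj_nat (3 * m) j = adj_nat (3 * m - 2) j.
Proof. by rewrite /adj_nat /adj_lt; lia. Qed.

Lemma edge_dir_adj_nat n i j : edge_dir n i j -> adj_nat i j.
Proof.
rewrite /adj_nat /adj_lt => /or3P[/eqP[-> ->]//||].
  move=> /existsP[k /andP[k1]]; rewrite !inE !xpair_eqE; lia.
by move=> /existsP[l /andP[l2]]; rewrite xpair_eqE; lia.
Qed.

Lemma adj_lt_edge_dir n i j : 0 < i -> j < 3 * n -> adj_lt i j ->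
  edge_dir n i j || edge_dir n j i.
Proof.
move=> i0 jn /or3P[/eqP jE|/andP[/eqP jE /eqP i1]|/andP[/eqP jE /eqP i3]].
- have [i1|neq] := eqVneq i 1.
    by rewrite jE i1 /edge_dir eqxx.
  have ltk : (i.+1) %/ 3 < n by lia.
  apply/orP; left; apply/or3P; apply: Or32; apply/existsP.
  have [r2|r2] := eqVneq (i %% 3) 2.
    exists (Ordinal ltk); rewrite !inE !xpair_eqE /=; lia.
  have ltk' : i %/ 3 < n by lia.
  exists (Ordinal ltk'); rewrite !inE !xpair_eqE /=; lia.
- have ltk : j %/ 3 < n by lia.
  apply/orP; right; apply/or3P; apply: Or32; apply/existsP.
  by exists (Ordinal ltk); rewrite !inE !xpair_eqE /=; lia.
- have ltk : j %/ 3 < n by lia.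
  apply/orP; left; apply/or3P; apply: Or33; apply/existsP.
  by exists (Ordinal ltk); rewrite !xpair_eqE /=; lia.
Qed.

Lemma edgeG_adj_nat n (i j : 'I_(3 * n)) : 0 < i -> 0 < j ->
  edgeG i j = adj_nat i j.
Proof.
move=> i0 j0; apply/orP/orP => [[|]/edge_dir_adj_nat|[]].
- by move/orP.
- by rewrite /adj_nat orbC => /orP.
- by move=> /(adj_lt_edge_dir i0 (ltn_ord j))/orP.
- by move=> /(adj_lt_edge_dir j0 (ltn_ord i)); rewrite orbC => /orP.
Qed.

(** * Shedding orders for copies of G_m and H_m *)

Section Labelling.
Variables (T : finType) (e : rel T).
Hypotheses (e_sym : ssrbool.symmetric e) (e_irr : irreflexive e).
Implicit Types (f : nat -> T) (s : seq nat).

Definition labels f s : {set T} := [set x in [seq f i | i <- s]].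

(** An embedded copy of G_m for N = 3m - 1, of H_m for N = 3m - 2. The recursion meets copies that
    are not initial segments of the vertices. *)
Definition labelling f N := forall i j, 0 < i <= N -> 0 < j <= N ->
  (f i = f j -> i = j) /\ e (f i) (f j) = adj_nat i j.

Lemma labellingW f N M : M <= N -> labelling f N -> labelling f M.
Proof. by move=> leMN lab i j iM jM; apply: lab; lia. Qed.

Lemma mem_labels f N s i : labelling f N -> {in s, forall j, 0 < j <= N} ->
  0 < i <= N -> (f i \in labels f s) = (i \in s).
Proof.
move=> lab sN iN; rewrite inE; apply/mapP/idP => [[j js fij]|is_]; last by exists i.
by have [inj _] := lab _ _ iN (sN _ js); rewrite (inj fij).
Qed.

Lemma eq_labels f s s' : s =i s' -> labels f s = labels f s'.
Proof. by move=> eqs; apply/setP => x; rewrite !inE; apply: eq_mem_map. Qed.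

Lemma labelsD1 f N s a : labelling f N -> {in s, forall j, 0 < j <= N} ->
  0 < a <= N -> labels f s :\ f a = labels f [seq i <- s | i != a].
Proof.
move=> lab sN aN; apply/setP => x; rewrite !inE; apply/andP/mapP.
  move=> [xa /mapP[i is_ xi]]; exists i => //; rewrite mem_filter is_ andbT.
  by apply: contraNneq xa => <-; rewrite xi.
move=> [i]; rewrite mem_filter => /andP[ia is_] ->; split; last exact: map_f.
by have [inj _] := lab _ _ (sN _ is_) aN; apply: contra_neq ia.
Qed.

Lemma labelsDN f N s a : labelling f N -> {in s, forall j, 0 < j <= N} ->
  0 < a <= N -> labels f s :\: (f a |: [set u | e (f a) u]) =
    labels f [seq i <- s | (i != a) && ~~ adj_nat a i].
Proof.
move=> lab sN aN; rewrite -setDDl (labelsD1 lab sN aN); apply/setP => x.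
rewrite !inE; apply/andP/mapP.
  move=> [ex /mapP[i]]; rewrite mem_filter => /andP[ia is_] xi.
  exists i => //; rewrite mem_filter ia is_ andbT /=.
  by have [_ <-] := lab _ _ aN (sN _ is_); rewrite -xi.
move=> [i]; rewrite mem_filter => /andP[/andP[ia nai] is_] ->.
have [_ ->] := lab _ _ aN (sN _ is_); split=> //.
by apply: map_f; rewrite mem_filter ia.
Qed.

(** The shedding vertex is x_(3m+3). Its deletion leaves G_(m+1) and the isolated vertex x_(3m+4);
    removing its neighbours x_(3m), x_(3m+2), x_(3m+4) as well leaves G_m and the isolated vertex
    x_(3m+1). *)
Lemma pure_vd_H_step f m :
  labelling f (3 * m.+2 - 2) ->
  pure_vd e m.+1 (labels f (iota 1 (3 * m.+1 - 1))) ->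
  pure_vd e m (labels f (iota 1 (3 * m - 1))) ->
  pure_vd e m.+2 (labels f (iota 1 (3 * m.+2 - 2))).
Proof.
move=> lab pvd1 pvd0.
have add a s M : (forall j, (j \in s) = (0 < j <= M)) -> M < a <= 3 * m.+2 - 2 ->
    (forall j, 0 < j <= M -> ~~ adj_nat a j) ->
    forall l, pure_vd e l (labels f s) -> pure_vd e l.+1 (labels f (a :: s)).
  move=> sM aM nadj l pvd.
  have -> : labels f (a :: s) = f a |: labels f s.
    by apply/setP => x; rewrite !inE.
  apply: pure_vd_isolated => //.
    by rewrite (mem_labels lab) ?sM; [lia|move=> j; rewrite sM; lia|lia].
  move=> u; rewrite inE => /mapP[j js ->]; rewrite sM in js.
  have [||_ ->] := lab a j; [lia|lia|exact: nadj].
apply: (@pure_vd_shed _ _ _ _ (f (3 * m.+2 - 3))).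
- by rewrite inE; apply: map_f; rewrite mem_iota; lia.
- rewrite (labelsD1 lab) => [|j|]; [|rewrite mem_iota; lia|lia].
  rewrite (@eq_labels _ _ (3 * m.+2 - 2 :: iota 1 (3 * m.+1 - 1))); last first.
    by move=> j; rewrite inE mem_filter !mem_iota; lia.
  apply: (@add _ _ (3 * m.+1 - 1)) => // [j||j]; rewrite ?mem_iota /adj_nat /adj_lt; lia.
rewrite (labelsDN lab) => [|j|]; [|rewrite mem_iota; lia|lia].
rewrite (@eq_labels _ _ (3 * m.+2 - 5 :: iota 1 (3 * m - 1))); last first.
  by move=> j; rewrite inE mem_filter !mem_iota /adj_nat /adj_lt; lia.
apply: (@add _ _ (3 * m - 1)) => // [j||j]; rewrite ?mem_iota /adj_nat /adj_lt; lia.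
Qed.

Lemma pure_vd_H1 f : pure_vd e 1 (labels f (iota 1 1)).
Proof.
have -> : labels f (iota 1 1) = [set f 1] by apply/setP => x; rewrite !inE.
have ind : indep e [set f 1] [set f 1].
  apply/indepP; split=> // x y.
  by rewrite !inE => /eqP -> /eqP ->; rewrite e_irr.
by have := pure_vd_edgeless ind; rewrite cards1.
Qed.

(* Without the closed neighbourhood of its last vertex, G_(m+1) becomes G_m, the
   role of x_(3m-2) being played by x_(3m). *)
Lemma pure_vd_G f m : labelling f (3 * m - 1) ->
  pure_vd e m (labels f (iota 1 (3 * m - 1))).
Proof.
have [l] := ubnP m; elim: l m f => // l IHl [|m] f ltml lab.
  have -> : labels f (iota 1 (3 * 0 - 1)) = set0.
    by apply/setP => x; rewrite !inE.
  have ind : indep e set0 set0 by apply/indepP; split=> // x y; rewrite inE.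
  by have := pure_vd_edgeless ind; rewrite cards0.
apply: (@pure_vd_shed _ _ _ _ (f (3 * m.+1 - 1))).
- by rewrite inE; apply: map_f; rewrite mem_iota; lia.
- rewrite (labelsD1 lab) => [|j|]; [|rewrite mem_iota; lia|lia].
  rewrite (@eq_labels _ _ (iota 1 (3 * m.+1 - 2))); last first.
    by move=> j; rewrite mem_filter !mem_iota; lia.
  (* The deletion leaves H_(m+2), which is shed into G_(m+1) and G_m: hence the strong induction. *)
  case: m ltml lab => [|m] ltml lab; first exact: pure_vd_H1.
  apply: pure_vd_H_step; first by apply: labellingW lab; lia.
    by apply: IHl; [lia|apply: labellingW lab; lia].
  by apply: IHl; [lia|apply: labellingW lab; lia].
pose g i := if i == 3 * m - 2 then 3 * m else i.
rewrite (labelsDN lab) => [|j|]; [|rewrite mem_iota; lia|lia].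
rewrite (@eq_labels _ _ [seq g i | i <- iota 1 (3 * m - 1)]); last first.
  move=> j; rewrite mem_filter mem_iota; apply/idP/mapP.
    rewrite /adj_nat /adj_lt => jP; exists (if j == 3 * m then 3 * m - 2 else j).
      by rewrite mem_iota; case: eqP; lia.
    by rewrite /g; case: eqP; case: eqP; lia.
  move=> [i]; rewrite mem_iota /g => iP ->; rewrite /adj_nat /adj_lt.
  by case: (i =P 3 * m - 2); lia.
have -> : labels f [seq g i | i <- iota 1 (3 * m - 1)] =
    labels (f \o g) (iota 1 (3 * m - 1)) by rewrite /labels -map_comp.
apply: IHl; first lia.
move=> i j iP jP.
have [||inj ->] := lab (g i) (g j); try by rewrite /g; case: eqP; lia.
split; first by move=> /= /inj; rewrite /g; case: eqP; case: eqP; lia.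
rewrite /g; have [-> |ni] := eqVneq i (3 * m - 2); have [-> |nj] := eqVneq j (3 * m - 2).
- by rewrite !adj_nat_irr.
- by rewrite adj_nat_relabel //; lia.
- by rewrite adj_natC adj_nat_relabel 1?adj_natC //; lia.
- by [].
Qed.

Lemma pure_vd_H f m : 0 < m -> labelling f (3 * m - 2) ->
  pure_vd e m (labels f (iota 1 (3 * m - 2))).
Proof.
case: m => [//|[|m]] _ lab; first exact: pure_vd_H1.
by apply: pure_vd_H_step => //; apply: pure_vd_G; apply: labellingW lab; lia.
Qed.

End Labelling.

(* The blocks {3j+1, 3j+2} cover the vertices other than the x_(3j): the block j
   either meets a maximal independent set, or misses it while one of x_(3j),
   x_(3j+3) and the block on the other side of it meet it. *)
Lemma maximal_indep_blocks n N (w : pred nat) j :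
  3 * n - 2 <= N -> j < n ->
  (forall i, w i -> 0 < i <= N) ->
  (forall i l, w i -> w l -> ~~ adj_nat i l) ->
  (forall i, 0 < i <= N -> ~~ w i -> exists2 l, w l & adj_nat i l) ->
  [\/ exists2 p, w p & p \in [:: 3 * j + 1; 3 * j + 2],
      [/\ 0 < j, w (3 * j) & exists2 p, w p & p \in [:: 3 * j - 2; 3 * j - 1]]
    | w (3 * j + 3) /\ exists2 p, w p & p \in [:: 3 * j + 4; 3 * j + 5]].
Proof.
move=> leN ltjn wN w_indep w_max.
have nbr p : 0 < p <= N -> ~~ w p -> exists2 l, w l &
    l = p.+1 \/ p = l.+1 \/ l = p + 4 /\ p %% 3 = 1 \/ p = l + 4 /\ l %% 3 = 1
    \/ l = p + 3 /\ p %% 3 = 0 \/ p = l + 3 /\ l %% 3 = 0.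
  move=> pN /(w_max p pN)[l wl adj]; exists l => //.
  by rewrite /adj_nat /adj_lt in adj; lia.
have [w1|w1] := boolP (w (3 * j + 1)).
  by apply: Or31; exists (3 * j + 1); rewrite ?mem_head.
have [w2|w2] := boolP (w (3 * j + 2)).
  by apply: Or31; exists (3 * j + 2); rewrite ?inE ?eqxx ?orbT.
have [|l wl lP] := nbr (3 * j + 1) _ w1; first by lia.
have [l2|[l0|l5]] : l = 3 * j + 2 \/ l = 3 * j \/ l = 3 * j + 5 by lia.
- by rewrite -l2 wl in w2.
- have j0 : 0 < j by have := wN _ wl; lia.
  rewrite l0 in wl; apply: Or32; split=> //.
  have [w1'|w1'] := boolP (w (3 * j - 2)); first by exists (3 * j - 2); rewrite ?mem_head.
  have [|q wq qP] := nbr (3 * j - 2) _ w1'; first by have := wN _ wl; lia.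
  have [q1|[q3|q2]] : q = 3 * j - 1 \/ q.+3 = 3 * j \/ q = 3 * j + 2 by lia.
  + by exists q => //; rewrite q1 !inE eqxx orbT.
  + by exfalso; have := w_indep _ _ wq wl; rewrite /adj_nat /adj_lt; lia.
  + by rewrite -q2 wq in w2.
rewrite l5 in wl; have [|q wq qP] := nbr (3 * j + 2) _ w2; first by have := wN _ wl; lia.
have [q3|[q1|q2]] : q = 3 * j + 3 \/ q = 3 * j + 1 \/ q + 4 = 3 * j + 2 by lia.
- apply: Or33; split; first by rewrite -q3.
  by exists (3 * j + 5) => //; rewrite !inE eqxx orbT.
- by rewrite -q1 wq in w1.
(* Here [w] contains x_(3j-2) and x_(3j+5). If x_(3j) is missing, it has a neighbour in [w];
   x_(3j-3) and x_(3j-1) are adjacent to x_(3j-2), so this neighbour is x_(3j+3). *)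
have [w0|w0] := boolP (w (3 * j)).
  apply: Or32; split=> //; first by have := wN _ wq; lia.
  by exists q => //; rewrite !inE; lia.
have [|t wt tP] := nbr (3 * j) _ w0; first by have := wN _ wq; have := wN _ wl; lia.
have [t1|[tq|t3]] : t = 3 * j + 1 \/ (t = q.+1 \/ q = t.+1) \/ t = 3 * j + 3 by lia.
- by rewrite -t1 wt in w1.
- by exfalso; have := w_indep _ _ wq wt; rewrite /adj_nat /adj_lt; lia.
apply: Or33; split; first by rewrite -t3.
by exists (3 * j + 5) => //; rewrite !inE eqxx orbT.
Qed.

(** The support of t_j: x_(3j+1) and x_(3j+2) lie in this block only, x_(3j) and x_(3j+3) also in an
    adjacent one. *)
Definition block n (j : nat) : pred 'I_(3 * n) :=
  fun u => 3 * j <= u <= 3 * j + 3.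

(** If [W] contains a vertex of block [i] only, its indicator is dual. Otherwise [W] contains a
    vertex shared with an adjacent block and a vertex of that adjacent block only, and the
    difference of their indicators is dual. *)
Lemma dual_vector_blocks (k : fieldType) n N (W : {set 'I_(3 * n)}) i :
  3 * n - 2 <= N < 3 * n -> i < n ->
  maxset (indep (@edgeG n) [set u : 'I_(3 * n) | 0 < u <= N]) W ->
  exists c : 'I_(3 * n) -> k,
    dual_vector [set u : 'I_(3 * n) | 0 < u <= N] (@block n) W n i c.
Proof.
set V := [set u | _] => Nn ltin /maxsetP[/indepP[WV eW] maxW].
have n0 : 0 < 3 * n by lia.
pose w (l : nat) := [exists u : 'I_(3 * n), (u \in W) && (l == u)].
have wP (l : nat) : reflect (exists2 u : 'I_(3 * n), u \in W & l = u) (w l).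
  apply: (iffP existsP) => [[u /andP[uW /eqP ->]]|[u uW ->]]; first by exists u.
  by exists u; rewrite uW eqxx.
have W0 (u : 'I_(3 * n)) : u \in W -> 0 < u <= N by move=> /(subsetP WV); rewrite inE.
have sum_delta j u : u \in W ->
    (\sum_(v in V | block j v) (v == u)%:R = (block j u)%:R :> k)%R.
  move=> uW; have uV := subsetP WV u uW; rewrite big_mkcondr /= (bigD1 u) //= eqxx.
  rewrite big1 => [|v /andP[_ /negbTE ->]]; last by case: ifP.
  by rewrite addr0; case: ifP.
have dual1 u : u \in W -> (forall j, j < n -> block j u = (j == i)) ->
    exists c : 'I_(3 * n) -> k, dual_vector V (@block n) W n i c.
  move=> uW bu; exists (fun v => (v == u)%:R)%R; split=> [v|j ltj].
    by move=> vW; case: eqP => [vu|_ //]; rewrite vu uW in vW.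
  by rewrite sum_delta ?bu.
have dual2 u v : u \in W -> v \in W ->
    (forall j, j < n -> block j u = (j == i) + block j v :> nat) ->
    exists c : 'I_(3 * n) -> k, dual_vector V (@block n) W n i c.
  move=> uW vW bu; exists (fun x => (x == u)%:R - (x == v)%:R)%R; split=> [x|j ltj].
    move=> xW; have [xu|_] := eqVneq x u; first by rewrite xu uW in xW.
    have [xv|_] := eqVneq x v; first by rewrite xv vW in xW.
    exact: subrr.
  by rewrite sumrB !sum_delta // bu // natrD addrK.
have ltN : 3 * n - 2 <= N by case/andP: Nn.
have w_indep l1 l2 : w l1 -> w l2 -> ~~ adj_nat l1 l2.
  move=> /wP[u uW ->] /wP[v vW ->]; have /andP[u0 _] := W0 _ uW.
  by have /andP[v0 _] := W0 _ vW; rewrite -edgeG_adj_nat ?eW.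
have w_max l : 0 < l <= N -> ~~ w l -> exists2 l', w l' & adj_nat l l'.
  move=> lN nwl; have ltl : l < 3 * n by lia.
  pose u := Ordinal ltl.
  have uW : u \notin W by apply: contra nwl => uW; apply/wP; exists u.
  have [v vW euv] : exists2 v, v \in W & edgeG u v.
    apply: contrapT => nex; move/negP: uW; apply.
    have nadj v : v \in W -> ~~ edgeG u v.
      by move=> vW; apply/negP => euv; apply: nex; exists v.
    rewrite -(maxW (u |: W)) ?setU11 ?subsetUr //; apply/indepP; split.
      by rewrite subUset sub1set WV inE /= lN.
    move=> x y; rewrite !inE => /predU1P[->|xW] /predU1P[->|yW].
    + by rewrite edgeG_irr.
    + exact: nadj.
    + by rewrite edgeG_sym nadj.
    + exact: eW.
  exists (nat_of_ord v); first by apply/wP; exists v.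
  have /andP[l0 _] := lN; have /andP[v0 _] := W0 _ vW.
  by rewrite -(@edgeG_adj_nat n u v).
have wN l : w l -> 0 < l <= N by move=> /wP[u uW ->]; apply: W0.
have [[p /wP[u uW ->] up]|[i0 /wP[u uW ui] [p /wP[v vW ->] vp]]
     |[/wP[u uW ui] [p /wP[v vW ->] vp]]] :=
  maximal_indep_blocks ltN ltin wN w_indep w_max.
- apply: (dual1 u) => // j _; rewrite /block; move: up; rewrite !inE.
  by case/orP=> /eqP ->; lia.
- apply: (dual2 u v) => // j _; rewrite /block -ui; move: vp; rewrite !inE.
  by case/orP=> /eqP ->; lia.
- apply: (dual2 u v) => // j _; rewrite /block -ui; move: vp; rewrite !inE.
  by case/orP=> /eqP ->; lia.
Qed.

Section GraphsGH.
Variables (n : nat).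
Hypothesis n_ge1 : 1 <= n.
Local Notation T := 'I_(3 * n).

Lemma vertex0_proof : 0 < 3 * n. Proof. by rewrite muln_gt0. Qed.

Definition vertex (i : nat) : T := insubd (Ordinal vertex0_proof) i.

Lemma vertexK i : i < 3 * n -> vertex i = i :> nat.
Proof. by move=> lti; rewrite insubdK. Qed.

Lemma labelling_vertex N : N < 3 * n -> labelling (@edgeG n) vertex N.
Proof.
move=> ltN i j iN jN.
have [vi vj] : vertex i = i :> nat /\ vertex j = j :> nat.
  by split; apply: vertexK; lia.
split=> [/(congr1 val)/=|]; first by rewrite vi vj.
by rewrite edgeG_adj_nat ?vi ?vj //; lia.
Qed.

Lemma labels_vertex N : N < 3 * n ->
  labels vertex (iota 1 N) = [set u : T | 0 < u <= N].
Proof.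
move=> ltN; apply/setP => u; rewrite !inE; apply/mapP/idP => [[i]|uN].
  by rewrite mem_iota => iN ->; rewrite vertexK; lia.
exists (u : nat); first by rewrite mem_iota; lia.
by apply: val_inj; rewrite /= vertexK.
Qed.

Lemma vertices_graphG : vertices (graphG n) = [set u : T | 0 < u <= 3 * n - 1].
Proof. by apply/setP => u; rewrite !inE; have := ltn_ord u; lia. Qed.

Lemma vertices_graphH : vertices (graphH n) = [set u : T | 0 < u <= 3 * n - 2].
Proof. by apply/setP => u; rewrite !inE; have := ltn_ord u; lia. Qed.

Lemma pure_vd_graphG : pure_vd (@edgeG n) n (vertices (graphG n)).
Proof.
rewrite vertices_graphG -labels_vertex; last by lia.
apply: pure_vd_G; [exact: edgeG_sym|exact: edgeG_irr|].
by apply: labelling_vertex; lia.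
Qed.

Lemma pure_vd_graphH : pure_vd (@edgeG n) n (vertices (graphH n)).
Proof.
rewrite vertices_graphH -labels_vertex; last by lia.
apply: pure_vd_H => //; [exact: edgeG_sym|exact: edgeG_irr|].
by apply: labelling_vertex; lia.
Qed.

End GraphsGH.

Theorem lemma3p6 (k : fieldType) (n : nat) (n_ge1 : 1 <= n) :
  [/\ well_covered (graphG n), vertex_decomposable (graphG n)
    & alpha (graphG n) = n] /\
  [/\ well_covered (graphH n), vertex_decomposable (graphH n)
    & alpha (graphH n) = n] /\
  cohen_macaulay_graph k (graphG n) /\ cohen_macaulay_graph k (graphH n).
Proof.
have pvdG := pure_vd_graphG n_ge1; have pvdH := pure_vd_graphH n_ge1.
have sym := @edgeG_sym n; have irr := @edgeG_irr n.
split; [|split; [|split]].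
- split; first exact: pure_vd_well_covered pvdG.
    exact: pure_vd_vertex_decomposable pvdG.
  exact: pure_vd_alpha pvdG.
- split; first exact: pure_vd_well_covered pvdH.
    exact: pure_vd_vertex_decomposable pvdH.
  exact: pure_vd_alpha pvdH.
- apply: (pure_vd_cohen_macaulay (G := graphG n) (b := @block n) pvdG) => W.
  by rewrite (vertices_graphG n_ge1) => maxW i lti; apply: dual_vector_blocks => //; lia.
- apply: (pure_vd_cohen_macaulay (G := graphH n) (b := @block n) pvdH) => W.
  by rewrite (vertices_graphH n_ge1) => maxW i lti; apply: dual_vector_blocks => //; lia.
Qed.
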